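(* Let $\mu$ be a compactly supported nontrivial probability measure on $\mathbb{R}$ with Jacobi parameters $a_n>0$, $b_n\in\mathbb{R}$ ($n\ge1$). Assume that for some $N_0\in\mathbb{N}$, $b_n\le b_{n+1}$ and $a_n\le a_{n+1}$ for all $n\ge N_0$, that $\lim_{n\to\infty}b_n=0$ and $\lim_{n\to\infty}a_n=1$, and that the sequences $(a_n)$, $(b_n)$ are not both eventually constant. Let $f$ be the density of the absolutely continuous part of $\mu$, continuous and strictly positive on $(-2,2)$. If $(p_{n-1}(2))_{n=1}^\infty$ is not a subordinate solution at $x=2$, then $$\left|\log f(x)+2\sum_{n=N_0}^{N(x)}\gamma_n(x)\right|\le 2h(x)+O(1),\qquad x\nearrow 2,$$ where $$e^{h(x)}=N(x)\left(b_{N(x)+2}-b_{N(x)+1}+a_{N(x)+2}-a_{N(x)+1}\right)^{-1}(2-x)^{1/2}$$ (with $h(x)=+\infty$ if the quantity in parentheses is zero).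
   Context: Nontrivial means not supported on a finite set. The orthonormal polynomials $p_n$ of $\mu$ ($p_0=1$, positive leading coefficients) satisfy $xp_n(x)=a_np_{n-1}(x)+b_{n+1}p_n(x)+a_{n+1}p_{n+1}(x)$ for $n\ge0$ (with $p_{-1}=0$); this defines the Jacobi parameters $a_n,b_n$, which are bounded. Under the assumptions on $a_n,b_n$, it is known that $d\mu=f(x)\,dx+d\mu_{\rm s}$ with $f$ continuous and strictly positive on $(-2,2)$, $f=0$ on $\mathbb{R}\setminus(-2,2)$, and $\mu_{\rm s}$ supported on $\mathbb{R}\setminus(-2,2)$. An eigensolution at $x$ is a sequence $u=(u_n)_{n=1}^\infty$ with $a_{n-1}u_{n-1}+b_nu_n+a_nu_{n+1}=xu_n$ for all $n\ge2$; $(p_{n-1}(x))_{n=1}^\infty$ is one. A nontrivial eigensolution $v$ at $x$ is subordinate if $\lim_{N\to\infty}\frac{\sum_{n=1}^N|v_n|^2}{\sum_{n=1}^N|u_n|^2}=0$ for every eigensolution $u$ at $x$ that is not a multiple of $v$. Under the assumptions, $b_{N_0}+2a_{N_0}<2$. For $x\in[b_{N_0}+2a_{N_0},2)$ define $N(x)=\max\{n\in\mathbb{N}: b_n+2a_n\le x\}$ and, for $N_0\le n\le N(x)$, $\gamma_n(x)=\operatorname{arccosh}\frac{x-b_n}{2a_n}$. *)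

(* Defs.v *)
From HB Require Import structures.
From mathcomp Require Import all_boot all_order all_algebra complex.
From mathcomp Require Import all_classical all_reals all_analysis.

Set Implicit Arguments.
Unset Strict Implicit.
Unset Printing Implicit Defensive.

Import Order.TTheory GRing.Theory Num.Theory.
Import numFieldNormedType.Exports.

Local Open Scope classical_set_scope.
Local Open Scope ring_scope.

(* MathComp-Analysis development.  Sequences indexed by n >= 1 are functions
   on nat whose value at 0 is irrelevant. *)

Section MeasureOnLine.
Context {R : realType}.
Implicit Types mu : probability (measurableTypeR R) R.

Definition compactly_supported mu :=
  exists2 K : set R, compact K & mu (~` K) = 0%E.

Definition nontrivial mu :=
  ~ exists2 A : set R, finite_set A & mu (~` A) = 0%E.

Definition orthonormal_polynomials mu (p : nat -> {poly R}) :=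
  [/\ p 0%N = 1,
      forall n, size (p n) = n.+1,
      forall n, 0 < lead_coef (p n) &
      forall m n, (\int[mu]_x ((p m).[x] * (p n).[x])%:E = (m == n)%:R%:E)%E].

Definition singular_measure
    (nu : {measure set (measurableTypeR R) -> \bar R}) :=
  exists Z : set (measurableTypeR R),
    [/\ measurable Z, lebesgue_measure Z = 0%E & nu (~` Z) = 0%E].

(* f is a version of the density in the Lebesgue decomposition
   d mu = f dx + d mu_s. *)
Definition ac_density mu (f : R -> R) :=
  [/\ measurable_fun setT f, forall x, 0 <= f x &
      exists2 mus : {measure set (measurableTypeR R) -> \bar R},
        singular_measure mus &
        forall A : set (measurableTypeR R), measurable A ->
          (mu A = \int[lebesgue_measure]_(x in A) (f x)%:E + mus A)%E].

End MeasureOnLine.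

Section JacobiParameters.
Context {R : realType}.
Implicit Types (a b : nat -> R) (x : R).

(* The first summand vanishes for n = 0, which encodes p_{-1} = 0; a 0 plays
   no role. *)
Definition jacobi_parameters (p : nat -> {poly R}) a b :=
  forall n, 'X * p n =
    (if n is k.+1 then a n *: p k else 0) + b n.+1 *: p n
    + a n.+1 *: p n.+1.

Definition eventually_constant (u : nat -> R) :=
  exists c, \forall n \near \oo, u n = c.

Definition eigensolution a b x (u : nat -> R[i]) :=
  forall n, (2 <= n)%N ->
    (a n.-1)%:C%C * u n.-1 + (b n)%:C%C * u n + (a n)%:C%C * u n.+1
    = x%:C%C * u n.

Definition multiple_of (v u : nat -> R[i]) :=
  exists c : R[i], forall n, (1 <= n)%N -> u n = c * v n.

Definition sum_sq (u : nat -> R[i]) (N : nat) : R :=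
  \sum_(1 <= n < N.+1) Normc.normc (u n) ^+ 2.

Definition subordinate a b x (v : nat -> R[i]) :=
  [/\ eigensolution a b x v,
      exists2 n, (1 <= n)%N & v n != 0 &
      forall u, eigensolution a b x u -> ~ multiple_of v u ->
        sum_sq v N / sum_sq u N @[N --> \oo] --> (0 : R)].

Definition arccosh (y : R) : R := ln (y + Num.sqrt (y ^+ 2 - 1)).

Lemma arccosh_ge0 (y : R) : 1 <= y -> 0 <= arccosh y.
Proof. by move=> y1; rewrite ln_ge0// (le_trans y1)// lerDl sqrtr_ge0. Qed.

Lemma cosh_arccosh (y : R) : 1 <= y ->
  (expR (arccosh y) + expR (- arccosh y)) / 2 = y.
Proof.
move=> y1; set s := Num.sqrt (y ^+ 2 - 1).
have y0 : 0 < y by rewrite (lt_le_trans _ y1).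
have ys0 : 0 < y + s by rewrite ltr_wpDr// sqrtr_ge0.
have s2 : s ^+ 2 = y ^+ 2 - 1 by rewrite sqr_sqrtr// subr_ge0 exprn_ege1.
have ysV : (y + s)^-1 = y - s.
  apply: (mulfI (lt0r_neq0 ys0)); rewrite divff ?lt0r_neq0//.
  by rewrite mulrC -subr_sqr s2 opprB addrCA subrr addr0.
rewrite expRN /arccosh -/s lnK ?posrE// ysV addrACA subrr addr0.
by rewrite -mulr2n -[y *+ 2]mulr_natr mulfK// pnatr_eq0.
Qed.

(* N(x) is the largest n >= 1 with b_n + 2 a_n <= x; the value is 0 when no
   such largest index exists. *)
Definition turning_index a b x : nat :=
  xget 0%N [set n | [/\ (1 <= n)%N, b n + 2 * a n <= x &
                       forall m, (1 <= m)%N -> b m + 2 * a m <= x ->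
                         (m <= n)%N]].

Definition gamma a b n x : R := arccosh ((x - b n) / (2 * a n)).

Definition increment a b x : R :=
  let N := turning_index a b x in
  b N.+2 - b N.+1 + a N.+2 - a N.+1.

Definition hfun a b x : \bar R :=
  if increment a b x == 0 then +oo%E
  else (ln ((turning_index a b x)%:R * (increment a b x)^-1
            * Num.sqrt (2 - x)))%:E.

End JacobiParameters.

(* Main.v *)
Require Import Defs.
From HB Require Import structures.
From mathcomp Require Import all_boot all_order all_algebra complex.
From mathcomp Require Import all_classical all_reals all_analysis.
From mathcomp Require Import measurable_realfun ring lra.
Import Order.TTheory GRing.Theory Num.Theory.
Import numFieldNormedType.Exports.
Local Open Scope classical_set_scope.
Local Open Scope ring_scope.

(** Put [u_n = p_(n-1)(x)], and let
      [A_n(x) = a_n^2 (u_n^2 + u_(n+1)^2) - (x - b_n) a_n u_n u_(n+1)]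
    be the scaled Turan determinant [turan].  Two properties of [A_n] carry the
    proof.

    The measures [A_n mu] converge to the semicircle law
    [sqrt (4 - x^2) / (2 pi) dx].  For polynomial test functions [q] this is
    algebra: the integrals of [q p_n p_(n+j)] are matrix elements of [q(J)] for
    the Jacobi matrix [J], and since [a_n -> 1] and [b_n -> 0] they converge to
    those of the free Jacobi matrix, which are the cosine coefficients of
    [q(2 cos t)] ([mean_cvg], [turan_cvg_semicircle]).  The total variations of
    the [A_n mu] are bounded, so tents, which are uniform limits of polynomials,
    may serve as test functions.  Hence, if [0 < L <= A_n <= U] near [x] for all
    large [n], then [mu] has no singular part near [x], and [f(x)] is at most
    [16 / L] and at least [1 / (16 U)] times the semicircle density
    ([density_bounds]).

    Let [N] be the turning index of [x], and [gap_n = b_n + 2 a_n - x], which is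
    positive for [n > N].  From there on, monotonicity of the coefficients makes
    [A_n / gap_n^2] decrease and [(1 + b_n) A_n] increase
    ([turan_tail_bounds]), so all later [A_n] lie between [A_(N+2) / 2] and
    [A_(N+2) ((2 - x) / gap_(N+2))^2].  The first index past [N] is skipped
    because [gap_(N+1)] can be arbitrarily small, while [gap_(N+2)] is at least
    the increment [D] in the definition of [h].

    Up to [N] the solution grows.  Comparison with [w_n], the product of the
    [e^gamma_j] for [m <= j < n], through two monotone Wronskian-like quantities
    gives [c w_n / n <= |u_n| <= C n w_n] ([growth_at_turning_index]), hence
    bounds for [A_(N+2)].  The comparison starts at an index [m] with
    [u_m^2 < u_m u_(m+1)], and [m] must not depend on [x].  By continuity it is
    enough to find [m] for [x = 2].  If there were none, [|p_n(2)|] would be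
    eventually nonincreasing, and then [p_n(2)] would be subordinate by
    constancy of the Wronskian ([decaying_subordinate]).

    Together, [f(x) w_(N+1)^2] is at most [K e^(2h)] and at least
    [e^(-2h) / K'] ([edge_estimate]); the powers of [N] and of [(2 - x) / D]
    lost on the way are the ones that [h] provides. *)

(** * Integrals of continuous functions over an interval *)

Section IntegralsOfContinuousFunctions.
Context {R : realType} (nu : {measure set (measurableTypeR R) -> \bar R}).
Context (lo hi : R) (nu_fin : (nu `[lo, hi]%classic < +oo)%E).
Implicit Types g h : R -> R.
Let D : set R := `[lo, hi]%classic.

Lemma continuous_integrable_itv g :
  continuous g -> nu.-integrable D (EFin \o g).
Proof.
move=> cg; apply: measurable_bounded_integrable => //.
- exact: measurable_itv.
- apply: measurable_funTS; exact: continuous_measurable_fun.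
- have /compact_bounded [B [_ hB]] : compact (g @` D).
    apply: continuous_compact; last exact: segment_compact.
    exact: continuous_subspaceT.
  exists B; split; first exact: num_real.
  by move=> y By x Dx /=; apply: hB => //; exists x.
Qed.

Lemma integral_itvD g h : continuous g -> continuous h ->
  \int[nu]_(x in D) (g x + h x)
  = \int[nu]_(x in D) g x + \int[nu]_(x in D) h x.
Proof.
by move=> cg ch; apply: RintegralD;
  [exact: measurable_itv|exact: continuous_integrable_itv..].
Qed.

Lemma integral_itvZ r g : continuous g ->
  \int[nu]_(x in D) (r * g x) = r * \int[nu]_(x in D) g x.
Proof.
by move=> cg; apply: RintegralZl; [exact: measurable_itv|
  exact: continuous_integrable_itv].
Qed.

Lemma le_integral_itv g h : continuous g -> continuous h ->
  (forall x, D x -> g x <= h x) ->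
  \int[nu]_(x in D) g x <= \int[nu]_(x in D) h x.
Proof.
by move=> cg ch gh; apply: le_Rintegral => //;
  [exact: measurable_itv|exact: continuous_integrable_itv..].
Qed.

End IntegralsOfContinuousFunctions.


(** * Weak convergence of Turan determinants to the semicircle law *)

Section ConstantCoefficientLimits.
Context {R : realType}.
Implicit Types (q : {poly R}).

Lemma continuous_scaled_cos (r : R) : continuous (fun t : R => cos (r * t)).
Proof.
move=> t; apply: (@continuous_comp _ _ _ ( *%R r) cos).
  by apply: cvgM; [exact: cvg_cst|exact: cvg_id].
exact: continuous_cos.
Qed.

Lemma continuous_horner_2cos q : continuous (fun t : R => q.[2 * cos t]).
Proof.
move=> t; apply: (@continuous_comp _ _ _ (fun t => 2 * cos t) (horner q)).
  by apply: cvgM; [exact: cvg_cst|exact: continuous_cos].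
exact: continuous_horner.
Qed.

(** The [j]-th cosine coefficient of [q (2 cos t)]. *)
Definition cos_coef (q : {poly R}) (j : nat) : R :=
  pi^-1 * \int[lebesgue_measure]_(t in `[0, pi]) (q.[2 * cos t] * cos (j%:R * t)).

Lemma continuous_cos_coef_integrand q j :
  continuous (fun t : R => q.[2 * cos t] * cos (j%:R * t)).
Proof.
by move=> t; apply: cvgM;
  [exact: continuous_horner_2cos|exact: continuous_scaled_cos].
Qed.

Lemma lebesgue_itv_fin (lo hi : R) :
  (lebesgue_measure (`[lo, hi]%classic : set R) < +oo)%E.
Proof. by rewrite lebesgue_measure_itv/=; case: ifP => _; rewrite ?ltry ?ltey. Qed.

Lemma cos_coefD q1 q2 j : cos_coef (q1 + q2) j = cos_coef q1 j + cos_coef q2 j.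
Proof.
rewrite /cos_coef -mulrDr -integral_itvD; first last.
- exact: continuous_cos_coef_integrand.
- exact: continuous_cos_coef_integrand.
- exact: lebesgue_itv_fin.
by congr (_ * _); apply: eq_Rintegral => t _; rewrite hornerD mulrDl.
Qed.

Lemma integral_cos_multiple (j : nat) :
  \int[lebesgue_measure]_(t in `[0, pi]) cos (j.+1%:R * t) = 0 :> R.
Proof.
have dS (x : R) : is_derive x 1 (fun t : R => j.+1%:R^-1 * sin (j.+1%:R * t))
    (cos (j.+1%:R * x)).
  apply: trigger_derive.
  by rewrite /GRing.scale/= mulr1 mulrCA mulVf ?mulr1// pnatr_eq0.
have cS : continuous (fun t : R => j.+1%:R^-1 * sin (j.+1%:R * t)).
  by move=> x; apply/differentiable_continuous/derivable1_diffP; case: (dS x).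
rewrite /Rintegral.
rewrite (@continuous_FTC2 _ _ (fun t : R => j.+1%:R^-1 * sin (j.+1%:R * t))).
- rewrite -EFinB mulr0 sin0 mulr0 subr0/=.
  suff -> : sin (j.+1%:R * pi) = 0 :> R by rewrite mulr0.
  clear; elim: j => [|j IH]; first by rewrite mul1r sinpi.
  by rewrite -[in LHS]natr1 mulrDl mul1r sinD sinpi IH mulr0 mul0r addr0.
- exact: pi_gt0.
- by apply: continuous_subspaceT; exact: continuous_scaled_cos.
- split.
  + by move=> x _; case: (dS x).
  + by apply: cvg_at_right_filter; exact: cS.
  + by apply: cvg_at_left_filter; exact: cS.
- by move=> x _; rewrite derive1E; case: (dS x).
Qed.


Lemma cos_coefC (r : R) j : cos_coef r%:P j = r * (j == 0%N)%:R.
Proof.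
rewrite /cos_coef; under eq_Rintegral do rewrite hornerC.
rewrite integral_itvZ; [|exact: lebesgue_itv_fin|exact: continuous_scaled_cos].
rewrite mulrCA; congr (_ * _); case: j => [|j]; last first.
  by rewrite integral_cos_multiple mulr0.
under eq_Rintegral do rewrite mul0r cos0.
rewrite Rintegral_cst; last exact: measurable_itv.
have pi0 := pi_gt0 R.
have h : lebesgue_measure (`[0, pi]%classic : set R) = pi%:E.
  by rewrite lebesgue_measure_itv/= lte_fin pi0/= oppr0 addr0.
rewrite (_ : fine _ = fine pi%:E); last by rewrite -h.
by rewrite /= mul1r mulVf// gt_eqF.
Qed.

Lemma cos_coefMX0 q : cos_coef (q * 'X) 0 = 2 * cos_coef q 1.
Proof.
rewrite /cos_coef mulrCA; congr (_ * _).
rewrite -integral_itvZ; first last.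
- exact: continuous_cos_coef_integrand.
- exact: lebesgue_itv_fin.
apply: eq_Rintegral => t _.
by rewrite hornerMX mul0r cos0 mul1r; ring.
Qed.

Lemma cos_coefMXS q j :
  cos_coef (q * 'X) j.+1 = cos_coef q j + cos_coef q j.+2.
Proof.
rewrite /cos_coef -mulrDr -integral_itvD; first last.
- exact: continuous_cos_coef_integrand.
- exact: continuous_cos_coef_integrand.
- exact: lebesgue_itv_fin.
congr (_ * _); apply: eq_Rintegral => t _; rewrite hornerMX.
have -> : j.+2%:R * t = j.+1%:R * t + t by rewrite -(natr1 j.+1) mulrDl mul1r.
have -> : j%:R * t = j.+1%:R * t - t by rewrite -(natr1 j) mulrDl mul1r addrK.
by rewrite !cosD cosN sinN; ring.
Qed.

End ConstantCoefficientLimits.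

Section MatrixElements.
Context {R : realType} (mu : probability (measurableTypeR R) R) (M : R).
Context (mu_supp : mu (~` `[- M, M]%classic) = 0%E).
Context (p : nat -> {poly R}) (p_orthonormal : orthonormal_polynomials mu p).
Implicit Types (q : {poly R}) (a b : nat -> R).

Lemma probability_itv_fin lo hi : (mu (`[lo, hi]%classic : set R) < +oo)%E.
Proof.
apply: (@le_lt_trans _ _ 1%E); last exact: ltry.
by apply: probability_le1; exact: measurable_itv.
Qed.

Definition mean q : R := \int[mu]_(x in `[- M, M]) q.[x].

Lemma meanD q1 q2 : mean (q1 + q2) = mean q1 + mean q2.
Proof.
rewrite /mean -integral_itvD; [|exact: probability_itv_fin|
  exact: continuous_horner..].
by apply: eq_Rintegral => x _; rewrite hornerD.
Qed.

Lemma meanZ r q : mean (r *: q) = r * mean q.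
Proof.
rewrite /mean -integral_itvZ; [|exact: probability_itv_fin|
  exact: continuous_horner].
by apply: eq_Rintegral => x _; rewrite hornerZ.
Qed.

Lemma mean_orthonormal m n : mean (p m * p n) = (m == n)%:R.
Proof.
have [_ _ _ /(_ m n)] := p_orthonormal.
have mD : measurable (`[- M, M]%classic : set (measurableTypeR R)).
  exact: measurable_itv.
have cpp : continuous (horner (p m * p n)) by exact: continuous_horner.
have TD : [set: R] `\` ~` `[- M, M] = `[- M, M]%classic by rewrite setTD setCK.
rewrite (@negligible_integral _ _ _ mu setT (~` `[- M, M]%classic))//.
- rewrite TD => h; rewrite /mean /Rintegral.
  by under eq_integral do rewrite hornerM; rewrite h.
- exact: measurableC.
- apply/(@negligible_integrable _ _ _ mu setT (~` `[- M, M]%classic)) => //.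
  + exact: measurableC.
  + apply/measurable_EFinP.
    rewrite (_ : (fun _ => _) = horner (p m * p n)).
      exact: continuous_measurable_fun.
    by apply/funext => x; rewrite hornerM.
  + rewrite TD; have := continuous_integrable_itv mu _ _ (probability_itv_fin _ _) _ cpp.
    rewrite (_ : EFin \o _ = fun x => ((p m).[x] * (p n).[x])%:E)//.
    by apply/funext => x /=; rewrite hornerM.
Qed.

Context (a b : nat -> R) (p_jacobi : jacobi_parameters p a b).
Context (a_lim : a n @[n --> \oo] --> (1 : R)).
Context (b_lim : b n @[n --> \oo] --> (0 : R)).

(** This is multiplication by the Jacobi matrix in the second index. *)
Lemma mean_recurrence q m n :
  mean (q * 'X * p m * p n.+1) = a n.+1 * mean (q * p m * p n)
    + b n.+2 * mean (q * p m * p n.+1) + a n.+2 * mean (q * p m * p n.+2).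
Proof.
rewrite -!meanZ -!meanD; congr mean.
transitivity (q * p m * ('X * p n.+1)); first by ring.
by rewrite p_jacobi !mulrDr -!scalerAr.
Qed.

(** Far out the recurrence coefficients are those of the free Jacobi matrix,
    for which multiplication by [x = 2 cos t] shifts cosine coefficients. *)
Lemma mean_cvg q j :
  mean (q * p n * p (n + j)%N) @[n --> \oo] --> cos_coef q j.
Proof.
elim/poly_ind: q j => [|q r IH] j.
  rewrite -polyC0 cos_coefC mul0r polyC0.
  rewrite (_ : (fun _ => _) = cst 0); first exact: cvg_cst.
  by apply/funext => n; rewrite !mul0r -(scale0r 0) meanZ mul0r.
rewrite cos_coefD.
have -> : (fun n => mean ((q * 'X + r%:P) * p n * p (n + j)%N)) =
    (fun n => mean (q * 'X * p n * p (n + j)%N) + r * (j == 0%N)%:R).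
  apply/funext => n; rewrite !mulrDl meanD -(mulrA r%:P) mul_polyC meanZ.
  rewrite mean_orthonormal (_ : (n == n + j)%N = (j == 0%N))//.
  by rewrite -[X in X == _]addn0 eqn_add2l eq_sym.
rewrite cos_coefC; apply: cvgD; last exact: cvg_cst.
have aS k : a (n + k)%N @[n --> \oo] --> (1 : R) by rewrite cvg_shiftn.
have bS k : b (n + k)%N @[n --> \oo] --> (0 : R) by rewrite cvg_shiftn.
case: j => [|j].
  rewrite cos_coefMX0 -cvg_shiftS.
  have -> : (fun n => mean (q * 'X * p n.+1 * p (n.+1 + 0)%N)) =
    (fun n => a (n + 1)%N * mean (q * p n * p (n + 1)%N)
            + b (n + 2)%N * mean (q * p n.+1 * p (n.+1 + 0)%N)
            + a (n + 2)%N * mean (q * p n.+1 * p (n.+1 + 1)%N)).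
    apply/funext => n; rewrite addn0 mean_recurrence !addn1 addn2.
    by rewrite -(mulrA q) (mulrC (p n.+1)) mulrA.
  rewrite (_ : 2 * _ = 1 * cos_coef q 1 + 0 * cos_coef q 0 + 1 * cos_coef q 1);
    last by ring.
  apply: cvgD; first apply: cvgD.
  - exact: cvgM (aS 1%N) (IH 1%N).
  - by apply: cvgM (bS 2%N) _; rewrite (cvg_shiftS (fun n => mean (q * p n * p (n + 0)%N))).
  - by apply: cvgM (aS 2%N) _; rewrite (cvg_shiftS (fun n => mean (q * p n * p (n + 1)%N))).
rewrite cos_coefMXS.
have -> : (fun n => mean (q * 'X * p n * p (n + j.+1)%N)) =
    (fun n => a (n + j.+1)%N * mean (q * p n * p (n + j)%N)
            + b (n + j.+2)%N * mean (q * p n * p (n + j.+1)%N)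
            + a (n + j.+2)%N * mean (q * p n * p (n + j.+2)%N)).
  by apply/funext => n; rewrite !addnS mean_recurrence.
rewrite (_ : cos_coef q j + _ = 1 * cos_coef q j + 0 * cos_coef q j.+1
    + 1 * cos_coef q j.+2); last by ring.
by apply: cvgD; [apply: cvgD|]; apply: cvgM.
Qed.

End MatrixElements.

Section Semicircle.
Context {R : realType}.
Implicit Types (q : {poly R}).

Definition semicircle (x : R) : R := Num.sqrt (4 - x ^+ 2) / (2 * pi).

Lemma continuous_semicircle : continuous semicircle.
Proof.
move=> x; apply: cvgM; last exact: cvg_cst.
apply: (@continuous_comp _ _ _ (fun x : R => 4 - x ^+ 2) Num.sqrt).
  by apply: cvgB; [exact: cvg_cst|exact: exprn_continuous].
exact: sqrt_continuous.
Qed.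

Lemma semicircle_ge0 x : 0 <= semicircle x.
Proof. by rewrite divr_ge0 ?sqrtr_ge0// mulr_ge0// ltW// pi_gt0. Qed.

Lemma semicircle_le1 x : semicircle x <= 1.
Proof.
have pi1 : 1 <= pi :> R by have := pi_ge2 R; lra.
rewrite ler_pdivrMr; last by have := pi_gt0 R; lra.
rewrite mul1r (@le_trans _ _ (Num.sqrt (2 ^+ 2)))//.
  rewrite ler_wsqrtr//; have := sqr_ge0 x; lra.
by rewrite sqrtr_sqr ger0_norm//; lra.
Qed.

Lemma semicircle_moment q :
  \int[lebesgue_measure]_(x in `[- 2, 2]) (q.[x] * semicircle x)
  = cos_coef q 0 - cos_coef q 2.
Proof.
pose F (t : R) := 2 * cos t; pose G x := q.[x] * semicircle x.
have pi0 := pi_gt0 R.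
have dF (x : R) : is_derive x 1 F (- (2 * sin x)).
  by apply: trigger_derive; rewrite /GRing.scale/= mulrN.
have F'E : (F^`())%classic = (fun t => - (2 * sin t)).
  by apply/funext => t; rewrite derive1E; case: (dF t).
have cF : continuous F.
  by move=> x; apply/differentiable_continuous/derivable1_diffP; case: (dF x).
have cF' : continuous (F^`())%classic.
  by rewrite F'E => x; apply: cvgN; apply: cvgM; [exact: cvg_cst|exact: continuous_sin].
have cG : continuous G.
  by move=> x; apply: cvgM; [exact: continuous_horner|exact: continuous_semicircle].
have := @integration_by_substitution_decreasing R F G 0 pi (ltW pi0).
rewrite /F cos0 cospi mulr1 mulrN1 => sub; rewrite /Rintegral sub //; clear sub; first last.
- exact: continuous_subspaceT.
- split; [by move=> x _; case: (dF x)| | ].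
    by apply: cvg_at_right_filter; exact: cF.
  by apply: cvg_at_left_filter; exact: cF.
- by apply/cvg_ex; exists ((F^`())%classic pi); apply: cvg_at_left_filter; exact: cF'.
- by apply/cvg_ex; exists ((F^`())%classic 0); apply: cvg_at_right_filter; exact: cF'.
- move=> x y; rewrite !in_itv/= => /andP[x0 xpi] /andP[y0 ypi] xy.
  by rewrite ltr_pM2l// ltr_cos// in_itv/= ?x0 ?y0.
rewrite /cos_coef -!integral_itvZ; [|exact: lebesgue_itv_fin|
  exact: continuous_cos_coef_integrand|exact: lebesgue_itv_fin|
  exact: continuous_cos_coef_integrand].
have ci j : lebesgue_measure.-integrable `[0, pi]%classic
    (EFin \o (fun t : R => pi^-1 * (q.[2 * cos t] * cos (j%:R * t)))).
  apply: continuous_integrable_itv; first exact: lebesgue_itv_fin.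
  by move=> t; apply: cvgM; [exact: cvg_cst|exact: continuous_cos_coef_integrand].
rewrite -RintegralB//.
apply: eq_Rintegral => t; rewrite inE/= in_itv/= => /andP[t0 tpi].
have sin0 : 0 <= sin t by apply: sin_ge0_pi; rewrite t0.
have sE : Num.sqrt (4 - F t ^+ 2) = 2 * sin t.
  have -> : 4 - F t ^+ 2 = (2 * sin t) ^+ 2.
    by rewrite !exprMn sin2cos2; ring.
  by rewrite sqrtr_sqr ger0_norm// mulr_ge0.
have c2 : cos (2%:R * t) = 1 - 2 * sin t ^+ 2.
  by rewrite mulr_natl cos_mulr2n cos2sin2; ring.
rewrite F'E !fctE/= opprK /G /semicircle sE mul0r cos0 c2.
by move: (pi : R) (lt0r_neq0 pi0) => P P0; field.
Qed.

End Semicircle.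

Section TuranDeterminant.
Context {R : realType}.
Implicit Types (a b u : nat -> R) (p : nat -> {poly R}) (x : R).

(** The Turan determinant [u_n^2 - (a_(n-1) / a_n) u_(n-1) u_(n+1)], scaled by
    [a_n^2] and with [u_(n-1)] eliminated through the recurrence. *)
Definition turan a b x u n : R :=
  a n ^+ 2 * (u n ^+ 2 + u n.+1 ^+ 2) - (x - b n) * a n * u n * u n.+1.

Definition turan_poly a b p n : {poly R} :=
  a n.+1 ^+ 2 *: (p n * p n + p n.+1 * p n.+1)
  - a n.+1 *: (('X - (b n.+1)%:P) * p n * p n.+1).

Lemma horner_turan_poly a b p n x :
  (turan_poly a b p n).[x] = turan a b x (fun k => (p k.-1).[x]) n.+1.
Proof. by rewrite /turan_poly /turan !hornerE/=; ring. Qed.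

Context (mu : probability (measurableTypeR R) R) (M : R).
Context (mu_supp : mu (~` `[- M, M]%classic) = 0%E).
Context (p : nat -> {poly R}) (p_orthonormal : orthonormal_polynomials mu p).
Context (a b : nat -> R) (p_jacobi : jacobi_parameters p a b).
Context (a_lim : a n @[n --> \oo] --> (1 : R)).
Context (b_lim : b n @[n --> \oo] --> (0 : R)).

(** The free Turan determinant [2 - 2 cos t cos t = 2 sin^2 t] turns the
    arcsine limit of [p_n^2 mu] into the semicircle law. *)
Lemma turan_cvg_semicircle q :
  mean mu M (q * turan_poly a b p n) @[n --> \oo] -->
  \int[lebesgue_measure]_(x in `[- 2, 2]) (q.[x] * semicircle x).
Proof.
have -> : (fun n => mean mu M (q * turan_poly a b p n)) =
  (fun n => a (n + 1)%N * a (n + 1)%N * (mean mu M (q * p n * p (n + 0)%N)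
      + mean mu M (q * p n.+1 * p (n.+1 + 0)%N))
    - a (n + 1)%N * (mean mu M (q * 'X * p n * p (n + 1)%N)
      - b (n + 1)%N * mean mu M (q * p n * p (n + 1)%N))).
  apply/funext => n; rewrite /turan_poly !addn0 !addn1.
  have meanN r : - mean mu M r = mean mu M (- r) by rewrite -(scaleN1r r) meanZ mulN1r.
  rewrite -!meanZ -!meanD meanN -!meanD -!meanZ meanN -!meanD.
  by congr mean; rewrite -!mul_polyC !rmorphM/=; ring.
have aS : a (n + 1)%N @[n --> \oo] --> (1 : R) by rewrite cvg_shiftn.
have bS : b (n + 1)%N @[n --> \oo] --> (0 : R) by rewrite cvg_shiftn.
have lim q' j := mean_cvg _ _ mu_supp _ p_orthonormal _ _ p_jacobi a_lim b_lim q' j.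
rewrite semicircle_moment (_ : _ - _ = 1 * 1 * (cos_coef q 0 + cos_coef q 0)
  - 1 * (cos_coef (q * 'X) 1 - 0 * cos_coef q 1)); last first.
  by rewrite cos_coefMXS; ring.
apply: cvgB.
  apply: cvgM; first exact: cvgM.
  apply: cvgD; first exact: lim.
  by rewrite (cvg_shiftS (fun n => mean mu M (q * p n * p (n + 0)%N))); exact: lim.
apply: cvgM => //; apply: cvgB; first exact: lim.
by apply: cvgM => //; exact: lim.
Qed.

End TuranDeterminant.

(** * Tents are uniform limits of polynomials *)

Section PolynomialApproximation.
Context {R : realType}.
Implicit Types (q : {poly R}).

Definition poly_approximable (B : R) (phi : R -> R) :=
  forall e, 0 < e -> exists q : {poly R},
    forall x, `|x| <= B -> `|phi x - q.[x]| <= e.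

(** Iterating [q |-> q + (x^2 - q^2) / 2] approximates the square root of [x^2]
    from below: the error [d] stays at most [2 / (k + 2)], because one step
    decreases it to at most [d (1 - d / 2)]. *)
Lemma abs_iteration k : exists q : {poly R}, forall x, `|x| <= 1 ->
  0 <= q.[x] /\ 0 <= `|x| - q.[x] <= 2 / k.+2%:R.
Proof.
elim: k => [|k [q hq]].
  by exists 0 => x x1; rewrite horner0 subr0 normr_ge0; split; lra.
exists (q + 2^-1 *: ('X^2 - q ^+ 2)) => x x1.
have [q0 /andP[d0 d1]] := hq x x1.
have k0 : 0 <= k%:R :> R by [].
rewrite !hornerE -[x ^+ 2](real_normK (num_real x)).
move: q0 d0 d1; set t := `|x|; set c := q.[x] => q0 d0 d1.
have t0 : 0 <= t by exact: normr_ge0.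
have t1 : t <= 1 by [].
split; first by nra.
apply/andP; split; first by nra.
pose d := t - c; have dE : c = t - d by rewrite /d; ring.
have e0 : 0 < k.+2%:R :> R by rewrite ltr0n.
apply: (@le_trans _ _ (d * (1 - d / 2))).
  by rewrite dE; rewrite /d in dE *; nra.
have k2E : k.+2%:R = k%:R + 2 :> R by rewrite -addn2 natrD.
have k3E : k.+3%:R = k%:R + 3 :> R by rewrite -addn3 natrD.
move: d1; rewrite -/d !ler_pdivlMr ?ltr0n// k2E k3E => d1.
have dt : d <= 1 by rewrite /d; lra.
have : 0 <= (2 - d * (k%:R + 2)) * (1 - d / 2) by apply: mulr_ge0; lra.
by have := sqr_ge0 d; lra.
Qed.

Lemma abs_approximable B : poly_approximable B (fun x => `|x|).
Proof.
move=> e e0.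
have B1 : 0 < `|B| + 1 by rewrite ltr_wpDl.
have [k hk] : exists k : nat, 2 / k.+2%:R <= e / (`|B| + 1).
  exists (Num.truncn (2 * (`|B| + 1) / e)); set k := Num.truncn _.
  have : 2 * (`|B| + 1) < k.+1%:R * e.
    by rewrite -ltr_pdivrMr//; exact: Num.Theory.truncnS_gt.
  rewrite ler_pdivrMr ?ltr0n// mulrAC ler_pdivlMr// -[k.+2%:R]natr1; nra.
have [q hq] := abs_iteration k.
exists ((`|B| + 1) *: (q \Po ((`|B| + 1)^-1 *: 'X))) => x xB.
rewrite !hornerE horner_comp !hornerE.
pose y := (`|B| + 1)^-1 * x.
have xE : x = (`|B| + 1) * y by rewrite /y mulVKf// gt_eqF.
have y1 : `|y| <= 1.
  rewrite /y normrM normfV (gtr0_norm B1) mulrC ler_pdivrMr// mul1r.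
  by apply: (le_trans xB); rewrite (le_trans (ler_norm B))// lerDl.
have [_ /andP[d0 d1]] := hq y y1.
rewrite -/y {1}xE normrM (gtr0_norm B1) -mulrBr normrM (gtr0_norm B1).
rewrite (ger0_norm d0) mulrC -ler_pdivlMr//; exact: le_trans hk.
Qed.

Definition tent (y r x : R) : R := (`|x - (y - r)| + `|x - (y + r)|) / 2 - `|x - y|.

Lemma tentE y r x : 0 <= r -> tent y r x = Num.max 0 (r - `|x - y|).
Proof.
move=> r0; rewrite /tent; have [xy|xy] := leP 0 (x - y);
  have [h1|h1] := leP 0 (x - (y - r)); have [h2|h2] := leP 0 (x - (y + r));
  rewrite ?(ger0_norm xy) ?(ger0_norm h1) ?(ger0_norm h2)
    ?(ltr0_norm xy) ?(ltr0_norm h1) ?(ltr0_norm h2) maxEle; case: ifP => ?; lra.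
Qed.

Lemma continuous_tent y r : continuous (tent y r).
Proof.
have cn c : continuous (fun x : R => `|x - c|).
  move=> x; apply: (@continuous_comp _ _ _ (fun x : R => x - c) Num.norm).
    by apply: cvgB; [exact: cvg_id|exact: cvg_cst].
  exact: norm_continuous.
move=> x; apply: cvgB; last exact: cn.
by apply: cvgM; [apply: cvgD; exact: cn|exact: cvg_cst].
Qed.

Lemma tent_approximable B y r : poly_approximable B (tent y r).
Proof.
move=> e e0; have e2 : 0 < e / 2 by rewrite divr_gt0.
have [q hq] := abs_approximable (`|B| + `|y| + `|r|) _ e2.
pose sh c := q \Po ('X - c%:P).
exists (2^-1 *: (sh (y - r) + sh (y + r)) - sh y) => x xB.
have apx c : `|c| <= `|y| + `|r| -> `| `|x - c| - (sh c).[x] | <= e / 2.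
  move=> hc; rewrite /sh horner_comp !hornerE; apply: hq.
  apply: (le_trans (ler_normB _ _)); rewrite -addrA; apply: lerD => //.
  exact: le_trans (ler_norm B).
have := apx (y - r) (ler_normB _ _); have := apx (y + r) (ler_normD _ _).
have := apx y; rewrite lerDl normr_ge0 => /(_ isT).
rewrite !hornerE /tent !ler_norml; lra.
Qed.

End PolynomialApproximation.

(** * Bounds on Turan determinants give bounds on the measure *)

Section MeasureBounds.
Context {R : realType} (mu : probability (measurableTypeR R) R) (M : R).
Context (M_ge2 : 2 <= M) (mu_supp : mu (~` `[- M, M]%classic) = 0%E).
Context (p : nat -> {poly R}) (p_orthonormal : orthonormal_polynomials mu p).
Context (a b : nat -> R) (p_jacobi : jacobi_parameters p a b).
Context (a_lim : a n @[n --> \oo] --> (1 : R)).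
Context (b_lim : b n @[n --> \oo] --> (0 : R)).
Local Notation T n := (turan_poly a b p n).

Lemma turan_norm_bound : \forall n \near \oo, forall x, `|x| <= M ->
  `|(T n).[x]| <= (M + 5) * (p n * p n + p n.+1 * p n.+1).[x].
Proof.
have aS : a (n + 1)%N @[n --> \oo] --> (1 : R) by rewrite cvg_shiftn.
have bS : b (n + 1)%N @[n --> \oo] --> (0 : R) by rewrite cvg_shiftn.
have a1 : \forall n \near \oo, `|1 - a (n + 1)%N| < 1 by have /cvgrPdist_lt/(_ 1 ltr01) := aS.
have b1 : \forall n \near \oo, `|0 - b (n + 1)%N| < 1 by have /cvgrPdist_lt/(_ 1 ltr01) := bS.
near=> n => x; rewrite ler_norml => /andP[x1 x2].
have : `|1 - a (n + 1)%N| < 1 by near: n.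
have : `|0 - b (n + 1)%N| < 1 by near: n.
rewrite !addn1 sub0r normrN !ltr_norml => /andP[b2 b3] /andP[a2 a3].
rewrite /turan_poly !hornerE/=.
move: (a n.+1) (b n.+1) (p n).[x] (p n.+1).[x] a2 a3 b2 b3 => A B u v a2 a3 b2 b3.
have A0 : 0 <= A by lra.
have A2 : A <= 2 by lra.
have uv := sqr_ge0 (u + v); have uv' := sqr_ge0 (u - v).
have S0 : 0 <= u * u + v * v by nra.
have h1 : A ^+ 2 * (u * u + v * v) <= 4 * (u * u + v * v).
  by apply: ler_wpM2r => //; nra.
have h2 : `|A * ((x - B) * u * v)| <= (M + 1) * (u * u + v * v).
  rewrite (_ : A * _ = (A * (x - B)) * (u * v)); last by ring.
  have h3 : `|A * (x - B)| <= 2 * (M + 1) by rewrite ler_norml; apply/andP; split; nra.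
  have h4 : `|u * v| <= (u * u + v * v) / 2 by rewrite ler_norml; apply/andP; split; nra.
  rewrite normrM [leRHS](_ : _ = 2 * (M + 1) * ((u * u + v * v) / 2)); last by field.
  by apply: ler_pM.
have h5 : 0 <= A ^+ 2 * (u * u + v * v) by rewrite mulr_ge0// sqr_ge0.
by move: h2; rewrite !ler_norml => /andP[h6 h7]; apply/andP; split; lra.
Unshelve. all: by end_near. Qed.

(** The total mass of [|T n| mu] stays bounded, which upgrades the convergence
    of moments to convergence against uniform limits of polynomials. *)
Lemma weak_limit_ge (phi psi : R -> R) : continuous phi -> continuous psi ->
  poly_approximable M phi ->
  (\forall n \near \oo, forall x, `|x| <= M -> psi x <= (T n).[x] * phi x) ->
  \int[mu]_(x in `[- M, M]) psi x
  <= \int[lebesgue_measure]_(x in `[- 2, 2]) (phi x * semicircle x).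
Proof.
move=> cphi cpsi aphi hpsi.
apply/ler_addgt0Pr => e e0.
(* [2 (M + 5)] bounds the mass of [|T n| mu]; [4] is the length of [-2, 2] *)
pose K := 2 * (M + 5) + 4; have K0 : 0 < K by rewrite /K; have := M_ge2; lra.
have [q hq] := aphi (e / K) (divr_gt0 e0 K0).
set d := e / K in hq.
have d0 : 0 < d by rewrite divr_gt0.
have inM x : x \in `[- M, M] -> `|x| <= M by rewrite in_itv/= ler_norml.
have in2 x : x \in `[- 2, 2] -> `|x| <= M.
  have M2 := M_ge2.
  by rewrite in_itv/= ler_norml => /andP[x1 x2]; apply/andP; split; lra.
have lim := turan_cvg_semicircle _ _ mu_supp _ p_orthonormal _ _ p_jacobi a_lim b_lim q.
have pp k : mean mu M (p k * p k) = 1 by rewrite mean_orthonormal// eqxx.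
have step : \int[mu]_(x in `[- M, M]) psi x - d * (M + 5) * 2
    <= \int[lebesgue_measure]_(x in `[- 2, 2]) (q.[x] * semicircle x).
  rewrite -(cvg_lim _ lim)//; apply: limr_ge; first by apply/cvg_ex; eexists; exact: lim.
  have tb := turan_norm_bound.
  near=> n.
  pose r := q * T n + (d * (M + 5)) *: (p n * p n + p n.+1 * p n.+1).
  have hr : \int[mu]_(x in `[- M, M]) psi x <= mean mu M r.
    apply: le_integral_itv => //; first exact: probability_itv_fin.
      exact: continuous_horner.
    move=> x /inM xM.
    have h1 : psi x <= (T n).[x] * phi x by move: x xM; near: n.
    have h2 : `|(T n).[x]| <= (M + 5) * (p n * p n + p n.+1 * p n.+1).[x].
      by move: x xM {h1}; near: n.
    apply: (le_trans h1); rewrite /r (hornerD (q * T n)) (hornerM q) hornerZ -lerBlDl mulrC -mulrBl.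
    apply: (le_trans (ler_norm _)); rewrite normrM -mulrA.
    by apply: ler_pM => //; exact: hq.
  move: hr; rewrite /r meanD meanZ meanD !pp; lra.
apply: (@le_trans _ _ (\int[lebesgue_measure]_(x in `[- 2, 2]) (phi x * semicircle x)
   + 4 * d + d * (M + 5) * 2)); last first.
  by rewrite -addrA lerD2l (_ : _ + _ = e)// /d; rewrite /K in K0 *; field; rewrite gt_eqF.
rewrite -lerBlDr; apply: (le_trans step).
have -> : 4 * d = \int[lebesgue_measure]_(x in `[- 2, 2]) d.
  rewrite Rintegral_cst; last exact: measurable_itv.
  have h : lebesgue_measure (`[- 2, 2]%classic : set R) = 4%:E.
    rewrite lebesgue_measure_itv/= lte_fin ifT; last by lra.
    by rewrite -EFinD; congr EFin; lra.
  by rewrite (_ : fine _ = fine 4%:E) 1?mulrC//; rewrite -h.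
have cps : continuous (fun x : R => phi x * semicircle x).
  by move=> x; apply: cvgM; [exact: cphi|exact: continuous_semicircle].
have cqs : continuous (fun x : R => q.[x] * semicircle x).
  by move=> x; apply: cvgM; [exact: continuous_horner|exact: continuous_semicircle].
have -> := esym (@integral_itvD R lebesgue_measure (- 2) 2
  (lebesgue_itv_fin _ _) _ (fun=> d) cps (fun x => cvg_cst _)).
apply: le_integral_itv => //; first exact: lebesgue_itv_fin.
  by move=> x; apply: cvgD; [exact: cps|exact: cvg_cst].
move=> x /in2 /hq; rewrite ler_norml => /andP[h1 h2].
have := semicircle_ge0 x; have := semicircle_le1 x; nra.
Unshelve. all: by end_near. Qed.

(** This is the previous bound for [- phi] and [- psi]. *)
Lemma weak_limit_le (phi psi : R -> R) : continuous phi -> continuous psi ->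
  poly_approximable M phi ->
  (\forall n \near \oo, forall x, `|x| <= M -> (T n).[x] * phi x <= psi x) ->
  \int[lebesgue_measure]_(x in `[- 2, 2]) (phi x * semicircle x)
  <= \int[mu]_(x in `[- M, M]) psi x.
Proof.
move=> cphi cpsi aphi hpsi.
have cps : continuous (fun x : R => phi x * semicircle x).
  by move=> x; apply: cvgM; [exact: cphi|exact: continuous_semicircle].
have := @weak_limit_ge (fun x => (-1) * phi x) (fun x => (-1) * psi x).
under [X in _ -> _ -> _ -> _ -> _ <= X]eq_Rintegral do rewrite -mulrA.
rewrite !integral_itvZ//; [|exact: lebesgue_itv_fin|exact: probability_itv_fin].
rewrite !mulN1r lerN2; apply.
- by move=> x; apply: cvgM; [exact: cvg_cst|exact: cphi].
- by move=> x; apply: cvgM; [exact: cvg_cst|exact: cpsi].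
- move=> e e0; have [q hq] := aphi e e0; exists (- q) => x /hq.
  by rewrite hornerN mulN1r -opprD normrN.
- near=> n => x xM; rewrite mulN1r mulN1r mulrN lerN2.
  by move: x xM; near: n.
Unshelve. all: by end_near. Qed.


Lemma integral_itv_indic (nu : {measure set (measurableTypeR R) -> \bar R})
    lo hi (A : set R) k : (nu `[lo, hi]%classic < +oo)%E ->
    measurable (A : set (measurableTypeR R)) -> A `<=` `[lo, hi]%classic ->
  nu.-integrable `[lo, hi]%classic (EFin \o (fun x => k * \1_A x)) /\
  \int[nu]_(x in `[lo, hi]) (k * \1_A x) = k * fine (nu A).
Proof.
move=> nufin mA Asub.
have mI : measurable (`[lo, hi]%classic : set (measurableTypeR R)).
  exact: measurable_itv.
have iA : nu.-integrable `[lo, hi]%classic (EFin \o (\1_A : R -> R)).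
  apply: measurable_bounded_integrable => //.
  exists 1; split; first exact: num_real.
  move=> y y1 x _ /=; apply: le_trans (ltW y1).
  by rewrite indicE; case: (_ \in _); rewrite ?normr1 ?normr0.
split; first exact: (integrableZl mI k iA).
rewrite RintegralZl//; congr (_ * _); rewrite /Rintegral integral_indic//.
by rewrite (setIidl Asub).
Qed.

(** The tent of half-width [2 r] at [y] is at least [r] on the ball of radius
    [r], and at most [2 r] on its support. *)
Section TentComparison.
Context (y r : R) (r_gt0 : 0 < r) (ylo : - 2 <= y - 2 * r) (yhi : y + 2 * r <= 2).
Let phi := tent y (2 * r).

Let phiE x : phi x = Num.max 0 (2 * r - `|x - y|).
Proof. by rewrite /phi tentE// mulr_ge0// ltW. Qed.

Let phi_ge0 x : 0 <= phi x.
Proof. by rewrite phiE le_max lexx. Qed.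

Let phi_out x : 2 * r <= `|x - y| -> phi x = 0.
Proof. by move=> h; rewrite phiE; apply/max_idPl; lra. Qed.

Let phi_le x : phi x <= 2 * r * \1_(`[y - 2 * r, y + 2 * r]%classic) x.
Proof.
have [h|h] := leP `|x - y| (2 * r); last first.
  by rewrite phi_out ?(ltW h)// mulr_ge0// mulr_ge0// ltW.
rewrite indicE mem_set ?mulr1; last first.
  by move: h; rewrite ler_norml /= in_itv/= => /andP[? ?]; apply/andP; split; lra.
rewrite phiE ge_max mulr_ge0 ?(ltW r_gt0)//=; have := normr_ge0 (x - y); lra.
Qed.

Let phi_ge x : r * \1_(`[y - r, y + r]%classic) x <= phi x.
Proof.
have r0 := r_gt0.
rewrite indicE; have [|_] := boolP (x \in _); last by rewrite mulr0.
rewrite inE/= in_itv/= => /andP[x1 x2]; rewrite mulr1 phiE le_max.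
apply/orP; right; have : `|x - y| <= r by rewrite ler_norml; apply/andP; split; lra.
lra.
Qed.

Let cphi : continuous phi.
Proof. exact: continuous_tent. Qed.

Let itv_in2 k : k <= 2 * r -> `[y - k, y + k]%classic `<=` `[- 2, 2]%classic.
Proof.
have [lo hi] := (ylo, yhi).
by move=> kr x; rewrite /= !in_itv/= => /andP[? ?]; apply/andP; split; lra.
Qed.

Let itv_inM k : k <= 2 * r -> `[y - k, y + k]%classic `<=` `[- M, M]%classic.
Proof.
have [[lo hi] M2] := ((ylo, yhi), M_ge2).
by move=> kr x; rewrite /= !in_itv/= => /andP[? ?]; apply/andP; split; lra.
Qed.

Let lebesgue_centered k : 0 < k ->
  fine (lebesgue_measure (`[y - k, y + k]%classic : set R)) = 2 * k.
Proof.
move=> k0; rewrite lebesgue_measure_itv/= lte_fin ifT; last by lra.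
by rewrite -EFinD/=; ring.
Qed.

Let cphis : continuous (fun x => phi x * semicircle x).
Proof. by move=> x; apply: cvgM; [exact: cphi|exact: continuous_semicircle]. Qed.

Lemma centered_measure_le L S : 0 < L ->
  (forall x, `|x - y| < 2 * r -> semicircle x <= S) ->
  (\forall n \near \oo, forall x, `|x - y| < 2 * r -> L <= (T n).[x]) ->
  L * fine (mu `[y - r, y + r]%classic) <= 8 * r * S.
Proof.
have r0 := r_gt0; move=> L0 hS hT.
have S0 : 0 <= S by apply: le_trans (hS y _); rewrite ?semicircle_ge0 ?subrr ?normr0 ?mulr_gt0.
have mI k : measurable (`[y - k, y + k]%classic : set (measurableTypeR R)).
  exact: measurable_itv.
have h1 : L * (r * fine (mu `[y - r, y + r]%classic)) <= L * \int[mu]_(x in `[- M, M]) phi x.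
  rewrite ler_pM2l//.
  have [i e] := @integral_itv_indic mu (- M) M _ r (probability_itv_fin mu _ _) (mI r)
    (itv_inM r ltac:(lra)).
  rewrite -e; apply: le_Rintegral => //.
    exact: continuous_integrable_itv (probability_itv_fin mu _ _) _ cphi.
have h2 : L * \int[mu]_(x in `[- M, M]) phi x
    <= \int[lebesgue_measure]_(x in `[- 2, 2]) (phi x * semicircle x).
  rewrite -integral_itvZ//; last exact: probability_itv_fin.
  apply: weak_limit_ge => //; first by move=> x; apply: cvgM; [exact: cvg_cst|exact: cphi].
    exact: tent_approximable.
  near=> n => x _; have [h|h] := ltP `|x - y| (2 * r); last by rewrite phi_out ?mulr0.
  by apply: ler_wpM2r => //; move: x h; near: n.
have h3 : \int[lebesgue_measure]_(x in `[- 2, 2]) (phi x * semicircle x)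
    <= 2 * r * S * (2 * (2 * r)).
  have [i e] := @integral_itv_indic lebesgue_measure (- 2) 2 _ (2 * r * S)
    (lebesgue_itv_fin _ _) (mI (2 * r)) (itv_in2 (2 * r) (lexx _)).
  rewrite -[2 * (2 * r)]lebesgue_centered ?mulr_gt0// -e; apply: le_Rintegral => //.
    exact: continuous_integrable_itv (lebesgue_itv_fin _ _) _ cphis.
  move=> x _; have [h|h] := ltP `|x - y| (2 * r); last first.
    by rewrite phi_out ?mul0r// mulr_ge0// mulr_ge0// mulr_ge0// ltW.
  rewrite mulrAC; apply: ler_pM => //; [exact: semicircle_ge0|exact: hS].
rewrite -(ler_pM2l r_gt0); have := le_trans h1 (le_trans h2 h3); lra.
Unshelve. all: by end_near. Qed.

Lemma centered_measure_ge U S : 0 <= U -> 0 <= S ->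
  (forall x, `|x - y| <= r -> S <= semicircle x) ->
  (\forall n \near \oo, forall x, `|x - y| < 2 * r -> (T n).[x] <= U) ->
  r * S <= U * fine (mu `[y - 2 * r, y + 2 * r]%classic).
Proof.
have r0 := r_gt0; move=> U0 S0 hS hT.
have mI k : measurable (`[y - k, y + k]%classic : set (measurableTypeR R)).
  exact: measurable_itv.
have h1 : U * \int[mu]_(x in `[- M, M]) phi x <=
    U * (2 * r * fine (mu `[y - 2 * r, y + 2 * r]%classic)).
  rewrite ler_wpM2l//.
  have [i e] := @integral_itv_indic mu (- M) M _ (2 * r)
    (probability_itv_fin mu _ _) (mI (2 * r))
    (itv_inM (2 * r) (lexx _)).
  rewrite -e; apply: le_Rintegral => //.
  exact: continuous_integrable_itv (probability_itv_fin mu _ _) _ cphi.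
have h2 : \int[lebesgue_measure]_(x in `[- 2, 2]) (phi x * semicircle x)
    <= U * \int[mu]_(x in `[- M, M]) phi x.
  rewrite -integral_itvZ//; last exact: probability_itv_fin.
  apply: weak_limit_le => //; first by move=> x; apply: cvgM; [exact: cvg_cst|exact: cphi].
    exact: tent_approximable.
  near=> n => x _; have [h|h] := ltP `|x - y| (2 * r); last by rewrite phi_out ?mulr0.
  by apply: ler_wpM2r => //; move: x h; near: n.
have h3 : r * S * (2 * r) <=
    \int[lebesgue_measure]_(x in `[- 2, 2]) (phi x * semicircle x).
  have [i e] := @integral_itv_indic lebesgue_measure (- 2) 2 _ (r * S)
    (lebesgue_itv_fin _ _) (mI r) (itv_in2 r ltac:(lra)).
  rewrite -[2 * r]lebesgue_centered// -e; apply: le_Rintegral => //.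
    exact: continuous_integrable_itv (lebesgue_itv_fin _ _) _ cphis.
  move=> x _; apply: (@le_trans _ _ (r * \1_(`[y - r, y + r]%classic) x * semicircle x)); last first.
    by apply: ler_wpM2r; rewrite ?semicircle_ge0.
  rewrite indicE; have [|_] := boolP (x \in _); last by rewrite !mulr0 mul0r.
  rewrite inE/= in_itv/= !mulr1 => /andP[x1 x2]; rewrite ler_pM2l//; apply: hS.
  by rewrite ler_norml; apply/andP; split; lra.
have h4 := le_trans h3 (le_trans h2 h1).
have r2 : 0 < 2 * r by rewrite mulr_gt0.
by rewrite -(ler_pM2l r2); lra.
Unshelve. all: by end_near. Qed.

End TentComparison.

End MeasureBounds.

(** * Absence of a singular part and bounds on the density *)

(** Covering the null set by intervals of small total length, each of which
    meets [J] inside an interval centered at a point of [J]. *)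
Lemma null_set_of_linear_bound (R : realType)
    (nu : {measure set (measurableTypeR R) -> \bar R})
    (Z J : set (measurableTypeR R)) (K e0 : R) :
    measurable Z -> measurable J -> 0 <= K -> 0 < e0 ->
    lebesgue_measure Z = 0%E ->
    (forall y rho, J y -> 0 < rho <= e0 ->
      (nu `[(y - rho)%R, (y + rho)%R]%classic <= (K * rho)%:E)%E) ->
  nu (Z `&` J) = 0%E.
Proof.
move=> mZ mJ K0 e00 Z0 hJ; apply/eqP; rewrite eq_le measure_ge0 andbT.
apply/lee_addgt0Pr => e epos; rewrite add0e.
pose d := Num.min e0 (e / (K + 1)).
have K1 : 0 < K + 1 by rewrite ltr_wpDl.
have d0 : 0 < d by rewrite lt_min e00 divr_gt0.
have /ereal_inf_lt[z [/= F [mF ZF] sFz] zd] : (lebesgue_measure Z < d%:E)%E.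
  by rewrite Z0 lte_fin.
set len := (X in (\sum_(k <oo) X (F k))%E = z) in sFz.
have len0 k : (0 <= len (F k))%E by exact: measure_ge0.
have mFk k : measurable (F k : set (measurableTypeR R)).
  exact: sub_sigma_algebra.
(* an interval [(c, c']] meeting [J] at [y] lies within [c' - c] of [y] *)
have FJ k : (nu (F k `&` J) <= K%:E * len (F k))%E.
  have [->|/set0P[y [Fy Jy]]] := eqVneq (F k `&` J) set0.
    by rewrite measure0 mule_ge0.
  have /ocitvP[Fk|[[c c'] /= cc' Fk]] : ocitv (F k) by exact: mF.
    by move: Fy; rewrite Fk.
  have lenE : len (F k) = (c' - c)%:E by rewrite /len Fk/= wlength_itv_bnd// ltW.
  have lend : (len (F k) <= d%:E)%E.
    apply: le_trans (ltW zd); rewrite -sFz.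
    apply: (le_trans _ (@nneseries_lim_ge _ (fun k => len (F k)) xpredT _ k.+1 _)) => //.
    by rewrite big_nat_recr//= leeDr// sume_ge0.
  have yI : c < y <= c' by move: Fy; rewrite Fk /= in_itv.
  rewrite lenE; apply: le_trans (hJ y (c' - c) Jy _); last first.
    move: lend; rewrite lenE lee_fin => /le_trans -> //; last by rewrite ge_min lexx.
    by rewrite subr_gt0 cc'.
  apply: le_measure; rewrite ?inE; [exact: measurableI|exact: measurable_itv|].
  move=> x [+ _]; rewrite Fk /= !in_itv/= => /andP[x1 x2].
  by move: yI => /andP[y1 y2]; apply/andP; split; lra.
apply: (@le_trans _ _ (\sum_(k <oo) nu (F k `&` J))%E).
  apply: measure_sigma_subadditive.
  - by move=> k; exact: measurableI.
  - exact: measurableI.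
  - by move=> x [/ZF[k _ Fkx] Jx]; exists k.
apply: (@le_trans _ _ (\sum_(k <oo) K%:E * len (F k))%E).
  by apply: lee_nneseries => k _; rewrite ?FJ.
rewrite nneseriesZl// sFz.
apply: (@le_trans _ _ (K%:E * d%:E)%E).
  by apply: lee_wpmul2l; [rewrite lee_fin|exact: ltW].
rewrite -EFinM lee_fin.
apply: (@le_trans _ _ (K * (e / (K + 1)))); first by rewrite ler_wpM2l// ge_min lexx orbT.
by rewrite mulrA ler_pdivrMr// mulrC ler_pM2l// lerDl.
Qed.

Section DensityComparison.
Context {R : realType} (mu : probability (measurableTypeR R) R) (M : R).
Context (M_ge2 : 2 <= M) (mu_supp : mu (~` `[- M, M]%classic) = 0%E).
Context (p : nat -> {poly R}) (p_orthonormal : orthonormal_polynomials mu p).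
Context (a b : nat -> R) (p_jacobi : jacobi_parameters p a b).
Context (a_lim : a n @[n --> \oo] --> (1 : R)).
Context (b_lim : b n @[n --> \oo] --> (0 : R)).
Context (f : R -> R) (f_density : ac_density mu f).
Local Notation T n := (turan_poly a b p n).

(** Small intervals around [x0] are compared with tents.  The upper bound for
    their measure is linear in the length, which kills the singular part, and
    then the lower bound is one for the integral of [f]. *)
Lemma density_bounds (x0 L U delta : R) : -2 < x0 < 2 ->
  {for x0, continuous f} -> 0 < f x0 -> 0 < L -> 0 < delta ->
  (\forall n \near \oo, forall x, `|x - x0| < delta -> L <= (T n).[x] <= U) ->
  semicircle x0 <= 16 * U * f x0 /\ L * f x0 <= 16 * semicircle x0.
Proof.
move=> /andP[x0lo x0hi] cf f0 L0 delta0 hT.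
have s0 : 0 < semicircle x0.
  rewrite divr_gt0 ?sqrtr_gt0 ?mulr_gt0 ?pi_gt0//; nra.
have [mf fge0 [mus [Z [mZ lZ musZ]] mufE]] := f_density.
have [d1 d10 hs] : exists2 d, 0 < d & forall x, `|x - x0| < d ->
    semicircle x0 / 2 <= semicircle x <= 2 * semicircle x0.
  have /cvgrPdist_lt/(_ (semicircle x0 / 2)) := @continuous_semicircle R x0.
  rewrite divr_gt0// => /(_ isT)/nbhs_ballP[d /= d0 h]; exists d => // x xd.
  have := h x; rewrite /ball/= distrC => /(_ xd); rewrite ltr_norml => /andP[? ?].
  by apply/andP; split; lra.
have [d2 d20 hf] : exists2 d, 0 < d & forall x, `|x - x0| < d ->
    f x0 / 2 <= f x <= 2 * f x0.
  have /cvgrPdist_lt/(_ (f x0 / 2)) := cf.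
  rewrite divr_gt0// => /(_ isT)/nbhs_ballP[d /= d0 h]; exists d => // x xd.
  have := h x; rewrite /ball/= distrC => /(_ xd); rewrite ltr_norml => /andP[? ?].
  by apply/andP; split; lra.
pose d := Num.min (Num.min d1 d2) (Num.min delta (Num.min (x0 + 2) (2 - x0))).
have dpos : 0 < d by rewrite !lt_min d10 d20 delta0/=; apply/andP; split; lra.
have [dd1 dd2 dd3 dd4 dd5] : [/\ d <= d1, d <= d2, d <= delta, d <= x0 + 2 & d <= 2 - x0].
  by split; rewrite !ge_min lexx ?orbT.
(* tents of half-width [2 rho <= 2 r] at points within [2 r] of [x0] must live
   within [d] of [x0] *)
pose r := d / 8; have r0 : 0 < r by rewrite divr_gt0.
have dE : d = 8 * r by rewrite /r; field.
have mI y k : measurable (`[y - k, y + k]%classic : set (measurableTypeR R)).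
  exact: measurable_itv.
have mufin (A : set (measurableTypeR R)) : measurable A -> mu A \is a fin_num.
  move=> mA; rewrite ge0_fin_numE//; apply: (@le_lt_trans _ _ 1%E); last exact: ltry.
  exact: probability_le1.
have leb y k : 0 < k -> lebesgue_measure (`[y - k, y + k]%classic : set R) = (2 * k)%:E.
  move=> k0; rewrite lebesgue_measure_itv/= lte_fin ifT; last by lra.
  by rewrite -EFinD; congr EFin; ring.
have U0 : 0 <= U.
  have [n /(_ x0)] := filter_ex hT.
  by rewrite subrr normr0 => /(_ delta0)/andP[LT TU]; exact: le_trans (ltW L0) (le_trans LT TU).
have up y rho : `|y - x0| <= 2 * r -> 0 < rho <= r ->
    L * fine (mu `[y - rho, y + rho]%classic) <= 16 * rho * semicircle x0.
  move=> yx /andP[rho0 rhor].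
  have near_x0 x : `|x - y| < 2 * rho -> `|x - x0| < d.
    move=> xy; apply: le_lt_trans (ler_distD y x x0) _; lra.
  rewrite (_ : 16 * _ * _ = 8 * rho * (2 * semicircle x0)); last by ring.
  move: yx; rewrite ler_norml => /andP[y1 y2].
  apply: (centered_measure_le _ _ M_ge2 mu_supp _ p_orthonormal _ _ p_jacobi a_lim b_lim) => //.
  - lra.
  - lra.
  - by move=> x /near_x0 xd; have /andP[] := hs x (lt_le_trans xd dd1).
  - near=> n => x /near_x0 xd.
    have /(_ x (lt_le_trans xd dd3))/andP[] : forall x, `|x - x0| < delta -> L <= (T n).[x] <= U.
      by near: n.
    by [].
have int_le y k c : 0 < k -> (forall x, `|x - y| <= k -> f x <= c) ->
    (\int[lebesgue_measure]_(x in `[(y - k)%R, (y + k)%R]) (f x)%:E <= (c * (2 * k))%:E)%E.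
  move=> k0 hc; apply: (@le_trans _ _
    (\int[lebesgue_measure]_(x in `[(y - k)%R, (y + k)%R]) c%:E)%E).
    apply: ge0_le_integral => //=.
    + by move=> x _; rewrite lee_fin.
    + by apply/measurable_EFinP; exact: measurable_funTS.
    + move=> x; rewrite in_itv/= => /andP[x1 x2]; rewrite lee_fin hc// ler_norml.
      by apply/andP; split; lra.
  by rewrite EFinM -(leb y k k0) integral_cst.
have int_ge y k c : 0 < k -> 0 <= c -> (forall x, `|x - y| <= k -> c <= f x) ->
    ((c * (2 * k))%:E <= \int[lebesgue_measure]_(x in `[(y - k)%R, (y + k)%R]) (f x)%:E)%E.
  move=> k0 c0 hc; apply: (@le_trans _ _
    (\int[lebesgue_measure]_(x in `[(y - k)%R, (y + k)%R]) c%:E)%E).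
    by rewrite EFinM -(leb y k k0) integral_cst.
  apply: ge0_le_integral => //=.
  + by apply/measurable_EFinP; exact: measurable_funTS.
  + move=> x; rewrite in_itv/= => /andP[x1 x2]; rewrite lee_fin hc// ler_norml.
    by apply/andP; split; lra.
split.
- have musJ : mus `[x0 - 2 * r, x0 + 2 * r]%classic = 0%E.
    have muZJ : mu (Z `&` `[x0 - 2 * r, x0 + 2 * r]) = 0%E.
      apply: (@null_set_of_linear_bound R mu _ _ (16 * semicircle x0 / L) r) => //.
        by apply: divr_ge0; [rewrite mulr_ge0// ltW|exact: ltW].
      move=> y rho; rewrite /= in_itv/= => /andP[y1 y2] rhor.
      rewrite -(fineK (mufin _ (mI y rho))) lee_fin.
      have := up y rho; rewrite ler_norml => /(_ _ rhor) h.
      rewrite mulrAC ler_pdivlMr// mulrC.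
      by rewrite [leRHS](_ : _ = 16 * rho * semicircle x0);
        [apply: h; apply/andP; split; lra|ring].
    have mJ := mI x0 (2 * r).
    have mJZ : measurable (`[x0 - 2 * r, x0 + 2 * r]%classic `&` Z) by exact: measurableI.
    apply/eqP; rewrite eq_le measure_ge0 andbT.
    rewrite -(setIT `[_, _]%classic) -(setUv Z) setIUr.
    apply: (le_trans (measureU2 _ _ _)) => //;
      first by apply: measurableI => //; exact: measurableC.
    rewrite -[X in (_ <= X)%E]adde0; apply: leeD.
      rewrite -muZJ setIC mufE; last exact: measurableI.
      by rewrite leeDr// integral_ge0// => x _; rewrite lee_fin.
    rewrite -musZ; apply: le_measure; rewrite ?inE; last by move=> x [].
      by apply: measurableI => //; exact: measurableC.
    exact: measurableC.
  have muJ : fine (mu `[x0 - 2 * r, x0 + 2 * r]%classic) <= 8 * r * f x0.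
    rewrite -lee_fin fineK; last exact: (mufin _ (mI _ _)).
    rewrite mufE; last exact: mI.
    rewrite musJ adde0 (_ : 8 * _ * _ = 2 * f x0 * (2 * (2 * r))); last by ring.
    apply: int_le; first by rewrite mulr_gt0.
    by move=> x xd; have /andP[] := hf x ltac:(lra).
  have : r * (semicircle x0 / 2) <= U * fine (mu `[x0 - 2 * r, x0 + 2 * r]%classic).
    apply: (centered_measure_ge _ _ M_ge2 mu_supp _ p_orthonormal _ _ p_jacobi a_lim b_lim) => //.
    + lra.
    + lra.
    + by rewrite divr_ge0// ltW.
    + by move=> x xd; have /andP[] := hs x ltac:(lra).
    + near=> n => x xd.
      have /(_ x ltac:(lra))/andP[] : forall x, `|x - x0| < delta -> L <= (T n).[x] <= U.
        by near: n.
      by [].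
  move=> h; have := le_trans h (ler_wpM2l U0 muJ) => {}h.
  by rewrite -(ler_pM2l r0); lra.
- have h1 := up x0 r; rewrite subrr normr0 r0 lexx in h1.
  have muJ : r * f x0 <= fine (mu `[x0 - r, x0 + r]%classic).
    rewrite -lee_fin fineK; last exact: (mufin _ (mI _ _)).
    rewrite mufE; last exact: mI.
    apply: (@le_trans _ _ (\int[lebesgue_measure]_(x in `[(x0 - r)%R, (x0 + r)%R]) (f x)%:E)%E).
      rewrite (_ : r * _ = f x0 / 2 * (2 * r)); last by field.
      apply: int_ge => //; first by rewrite divr_ge0// ltW.
      by move=> x xd; have /andP[] := hf x ltac:(lra).
    by rewrite leeDl.
  have h2 := h1 ltac:(lra) isT.
  have := le_trans (ler_wpM2l (ltW L0) muJ) h2 => {}h1.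
  by rewrite -(ler_pM2l r0); lra.
Unshelve. all: by end_near. Qed.

End DensityComparison.

(** * Turan determinants past the turning index *)

Section TuranMonotonicity.
Context {R : realType}.
Implicit Types (a b u : nat -> R) (x : R).

Definition three_term a b x u :=
  forall n, (1 <= n)%N -> a n.+1 * u n.+2 = (x - b n.+1) * u n.+1 - a n * u n.

Definition edge_gap a b x n : R := b n + 2 * a n - x.

(** [A_n] is conserved when the coefficients are constant. *)
Lemma turan_step a b x u n : three_term a b x u -> (1 <= n)%N ->
  turan a b x u n.+1 = turan a b x u n
    + (b n.+1 - b n) * (a n * u n * u n.+1)
    + (a n.+1 ^+ 2 - a n ^+ 2) * u n.+1 ^+ 2.
Proof.
move=> rec n1; rewrite /turan.
have -> : a n.+1 ^+ 2 * (u n.+1 ^+ 2 + u n.+2 ^+ 2)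
    - (x - b n.+1) * a n.+1 * u n.+1 * u n.+2
  = a n.+1 ^+ 2 * u n.+1 ^+ 2 + (a n.+1 * u n.+2) ^+ 2
    - (x - b n.+1) * u n.+1 * (a n.+1 * u n.+2) by ring.
by rewrite rec//; ring.
Qed.

(** The difference is [a_n (x - b_n) / 2] times [(u_n - u_(n+1))^2]. *)
Lemma turan_ge a b x u n : 0 <= a n -> b n <= x ->
  a n * edge_gap a b x n / 2 * (u n ^+ 2 + u n.+1 ^+ 2) <= turan a b x u n.
Proof.
move=> a0 bx; rewrite -subr_ge0.
rewrite [leRHS](_ : _ = a n * (x - b n) / 2 * (u n - u n.+1) ^+ 2).
  by rewrite mulr_ge0 ?sqr_ge0// divr_ge0// mulr_ge0// subr_ge0.
by rewrite /turan /edge_gap; field.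
Qed.

Lemma turan_ge_cross a b x u n : 0 <= a n -> b n <= x ->
  0 <= edge_gap a b x n ->
  edge_gap a b x n * (a n * u n * u n.+1) <= turan a b x u n.
Proof.
move=> a0 bx k0; rewrite -subr_ge0.
rewrite [leRHS](_ : _ = a n ^+ 2 * (u n - u n.+1) ^+ 2).
  by rewrite mulr_ge0 ?sqr_ge0.
by rewrite /turan /edge_gap; ring.
Qed.

Lemma turan_ge0 a b x u n : 0 <= a n -> b n <= x -> 0 <= edge_gap a b x n ->
  0 <= turan a b x u n.
Proof.
move=> a0 bx k0; apply: le_trans (turan_ge a b x u n a0 bx).
by rewrite mulr_ge0 ?addr_ge0 ?sqr_ge0// divr_ge0// mulr_ge0.
Qed.

Section Step.
Context (a b u : nat -> R) (x : R) (n : nat).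
Context (rec : three_term a b x u) (n1 : (1 <= n)%N) (a0 : 0 <= a n)
  (aS : a n <= a n.+1) (bS : b n <= b n.+1) (bx : b n <= x)
  (k0 : 0 <= edge_gap a b x n).

(** [gap_n a_n u_n u_(n+1)] and [gap_n a_n u_(n+1)^2 / 2] are at most [A_n], so
    one step multiplies [A_n] by at most
    [1 + (db + 4 da + ...) / gap_n <= (1 + (db + 2 da) / gap_n)^2]; the second
    order terms fit because [gap_n <= 2 a_n] when [b_n <= x]. *)
Lemma turan_gap_step :
  turan a b x u n.+1 * edge_gap a b x n ^+ 2
  <= turan a b x u n * edge_gap a b x n.+1 ^+ 2.
Proof.
have [[h1 h2] [[h3 h4] h5]] := ((a0, aS), ((bS, bx), k0)).
have A0 := turan_ge0 a b x u n h1 h4 h5.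
have A1 := turan_ge a b x u n h1 h4.
have A2 := turan_ge_cross a b x u n h1 h4 h5.
rewrite turan_step//.
move: A0 A1 A2; set A := turan a b x u n; set c := a n * u n * u n.+1.
set v := u n.+1 ^+ 2; set k := edge_gap a b x n => A0 A1 A2.
pose be := b n.+1 - b n; pose al := a n.+1 - a n.
have v0 : 0 <= v by exact: sqr_ge0.
have be0 : 0 <= be by rewrite /be; lra.
have al0 : 0 <= al by rewrite /al; lra.
have ka : k <= 2 * a n by rewrite /k /edge_gap; lra.
have kS : edge_gap a b x n.+1 = k + be + 2 * al by rewrite /k /edge_gap /be /al; ring.
have -> : a n.+1 ^+ 2 - a n ^+ 2 = al * (2 * a n + al) by rewrite /al; ring.
have A3 : a n * k / 2 * v <= A.
  apply: le_trans A1; rewrite ler_wpM2l ?lerDr ?sqr_ge0//.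
  by rewrite divr_ge0// mulr_ge0.
rewrite kS -/be.
have e1 : be * k * (k * c) <= be * k * A by rewrite ler_wpM2l// mulr_ge0.
have e2 : al * k * (4 * (a n * k / 2 * v)) <= al * k * (4 * A).
  by rewrite ler_wpM2l ?mulr_ge0// ler_pM2l.
have e3 : al ^+ 2 * (4 * (a n * k / 2 * v)) <= al ^+ 2 * (4 * A).
  by rewrite ler_wpM2l ?sqr_ge0// ler_pM2l.
have e4 : al ^+ 2 * v * k * k <= al ^+ 2 * v * k * (2 * a n).
  by rewrite ler_wpM2l// mulr_ge0// mulr_ge0// sqr_ge0.
have e5 : 0 <= be * k * A by rewrite !mulr_ge0.
have e6 : 0 <= be ^+ 2 * A by rewrite mulr_ge0// sqr_ge0.
have e7 : 0 <= be * al * A by rewrite !mulr_ge0.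
have -> : (A + be * c + al * (2 * a n + al) * v) * k ^+ 2 =
  A * k ^+ 2 + be * k * (k * c) + al * k * (4 * (a n * k / 2 * v))
    + al ^+ 2 * v * k * k by field.
have -> : A * (k + be + 2 * al) ^+ 2 = A * k ^+ 2 + 2 * (be * k * A)
  + al * k * (4 * A) + al ^+ 2 * (4 * A) + be ^+ 2 * A + 4 * (be * al * A) by ring.
have e8 : al ^+ 2 * v * k * (2 * a n) = al ^+ 2 * (4 * (a n * k / 2 * v)) by field.
lra.
Qed.

(** Only a negative product [u_n u_(n+1)] can make [A_n] decrease, and then
    [A_n] is at least [2 a_n^2] times its absolute value. *)
Lemma turan_weighted_step : 2^-1 <= a n -> -1 <= b n -> b n.+1 <= 0 ->
  (1 + b n) * turan a b x u n <= (1 + b n.+1) * turan a b x u n.+1.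
Proof.
move=> ah b1 b0.
have [[h1 h2] [[h3 h4] h5]] := ((a0, aS), ((bS, bx), k0)).
have A0 := turan_ge0 a b x u n h1 h4 h5.
rewrite turan_step//.
set A := turan a b x u n in A0 *; set c := a n * u n * u n.+1.
pose be := b n.+1 - b n; have be0 : 0 <= be by rewrite /be; lra.
have cA : - A <= c.
  have [c0|c0] := leP 0 c; first by rewrite (le_trans _ c0)// oppr_le0.
  have : 0 <= (x - b n - 1 + 1) * (- c).
    by rewrite mulr_ge0//; lra.
  have : 0 <= a n ^+ 2 * (u n + u n.+1) ^+ 2 by rewrite mulr_ge0 ?sqr_ge0.
  have : 0 <= (2 * a n - 1) * (- c) by rewrite mulr_ge0//; lra.
  have -> : A = a n ^+ 2 * (u n + u n.+1) ^+ 2 - 2 * a n * c - (x - b n) * c.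
    by rewrite /A /turan /c; ring.
  lra.
have v0 : 0 <= (a n.+1 ^+ 2 - a n ^+ 2) * u n.+1 ^+ 2.
  by rewrite mulr_ge0 ?sqr_ge0// subr_ge0 ler_sqr ?nnegrE// (le_trans h1).
set w := (_ * u n.+1 ^+ 2) in v0 *.
have e1 : be * (- A) <= be * c by rewrite ler_wpM2l.
have e2 : 0 <= (1 + b n.+1) * (be * c + be * A) by rewrite mulr_ge0; lra.
have e3 : 0 <= (1 + b n.+1) * w by rewrite mulr_ge0//; lra.
have e4 : 0 <= be * (- b n.+1) * A by rewrite !mulr_ge0//; lra.
rewrite -/be; have -> : b n = b n.+1 - be by rewrite /be; ring.
lra.
Qed.

End Step.

(** Where the recurrence oscillates, [A_n / gap_n^2] decreases and
    [(1 + b_n) A_n] increases; moreover [gap_n <= 2 - x] and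
    [-1/2 <= b_n <= 0]. *)
Lemma turan_tail_bounds a b u x m :
  three_term a b x u -> (1 <= m)%N -> 0 <= x ->
  (forall n, (m <= n)%N -> a n <= a n.+1 /\ b n <= b n.+1) ->
  (forall n, (m <= n)%N -> 2^-1 <= a n <= 1 /\ - 2^-1 <= b n <= 0) ->
  0 < edge_gap a b x m ->
  forall n, (m <= n)%N ->
  turan a b x u m / 2 <= turan a b x u n
    <= turan a b x u m * ((2 - x) / edge_gap a b x m) ^+ 2.
Proof.
move=> rec m1 x0 mono bnd gap0 n mn.
have gap k : (m <= k)%N -> edge_gap a b x m <= edge_gap a b x k <= 2 - x.
  move=> mk; apply/andP; split; last first.
    by have [/andP[? ?] /andP[? ?]] := bnd k mk; rewrite /edge_gap; lra.
  elim: k mk => [|k IH]; first by rewrite leqn0 => /eqP ->.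
  rewrite leq_eqVlt => /predU1P[->//|mk].
  by have [? ?] := mono k mk; have := IH mk; rewrite /edge_gap; lra.
have ge0 k : (m <= k)%N -> 0 <= turan a b x u k.
  move=> mk; have [/andP[? ?] /andP[? ?]] := bnd k mk; have /andP[? ?] := gap k mk.
  by apply: turan_ge0; lra.
have main k : (m <= k)%N ->
  (1 + b m) * turan a b x u m <= (1 + b k) * turan a b x u k /\
  turan a b x u k * edge_gap a b x m ^+ 2
    <= turan a b x u m * edge_gap a b x k ^+ 2.
  elim: k => [|k IH]; first by rewrite leqn0 => /eqP ->.
  rewrite leq_eqVlt => /predU1P[->//|mk].
  have [l1 l2] := IH mk.
  have k1 : (1 <= k)%N by exact: leq_trans m1 mk.
  have [/andP[? ?] /andP[? ?]] := bnd k mk; have /andP[? ?] := gap k mk.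
  have [_ /andP[? ?]] := bnd k.+1 (leqW (mk : (m <= k)%N)).
  have [? ?] := mono k mk.
  have kpos : 0 < edge_gap a b x k ^+ 2 by rewrite exprn_gt0//; lra.
  split; first by apply: le_trans l1 _; apply: turan_weighted_step => //; lra.
  rewrite -(ler_pM2r kpos) mulrAC.
  apply: (@le_trans _ _ (turan a b x u k * edge_gap a b x k.+1 ^+ 2
                         * edge_gap a b x m ^+ 2)).
    by rewrite ler_wpM2r ?sqr_ge0//; apply: turan_gap_step => //; lra.
  by rewrite mulrAC [leRHS]mulrAC ler_wpM2r ?sqr_ge0.
have [l1 l2] := main n mn; have /andP[g1 g2] := gap n mn.
have [_ /andP[bm bm']] := bnd m (leqnn m); have [_ /andP[bn bn']] := bnd n mn.
apply/andP; split.
  have := ge0 n mn; have := ge0 m (leqnn m); nra.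
rewrite expr_div_n mulrA ler_pdivlMr ?exprn_gt0//.
apply: le_trans l2 _; rewrite ler_wpM2l ?ge0// ler_sqr ?nnegrE//; lra.
Qed.

End TuranMonotonicity.

(** * Growth of solutions up to the turning index *)

Section GrowthUpToTurningIndex.
Context {R : realType} (a b u w G H : nat -> R) (x : R) (m N : nat).
Context (rec : three_term a b x u) (m1 : (1 <= m)%N).
Context (a_bnd : forall n, (m <= n)%N -> 2^-1 <= a n <= 1 /\ a n <= a n.+1).
Context (GH_sum : forall n, (m <= n <= N)%N -> G n + H n = x - b n).
Context (GH_prod : forall n, (m <= n <= N)%N -> G n * H n = a n ^+ 2).
Context (GH_a : forall n, (m <= n <= N)%N -> 0 < H n <= a n /\ a n <= G n).
Context (b_mono : forall n, (m <= n)%N -> b n <= b n.+1).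
Context (wm : w m = 1).
Context (wS : forall n, (m <= n <= N)%N -> a n * w n.+1 = G n * w n).
Context (um : u m = 1) (umS : 1 <= u m.+1).

(** [G n] and [H n] are the roots of [t^2 - (x - b_n) t + a_n^2]; the sum
    decreases and the product increases with [n], so the roots approach each
    other. *)
Lemma characteristic_roots_mono n : (m <= n)%N -> (n < N)%N ->
  G n.+1 <= G n /\ H n <= H n.+1.
Proof.
move=> mn nN.
have i1 : (m <= n <= N)%N by rewrite mn ltnW.
have i2 : (m <= n.+1 <= N)%N by rewrite leqW.
have [s1 s2] := (GH_sum n i1, GH_sum n.+1 i2).
have [q1 q2] := (GH_prod n i1, GH_prod n.+1 i2).
have [/andP[h1 h2] h3] := GH_a n i1; have [/andP[h4 h5] h6] := GH_a n.+1 i2.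
have bn := b_mono n mn; have [/andP[a1 a2] aS] := a_bnd n mn.
(* the old characteristic polynomial is nonpositive at the new larger root *)
have key : (G n.+1 - G n) * (G n.+1 - H n) <= 0 by nra.
have GG : G n.+1 <= G n.
  rewrite leNgt; apply/negP => lt.
  have : 0 < (G n.+1 - G n) * (G n.+1 - H n) by apply: mulr_gt0; lra.
  lra.
split=> //.
have : G n * H n <= G n * H n.+1.
  rewrite q1; apply: (@le_trans _ _ (G n.+1 * H n.+1)); last by rewrite ler_wpM2r// ltW.
  by rewrite q2 ler_sqr ?nnegrE; lra.
by rewrite ler_pM2l//; lra.
Qed.

Lemma gauge_gt0 n : (m <= n <= N.+1)%N -> 0 < w n.
Proof.
elim: n => [|n IH] /andP[].
  by rewrite leqn0 => /eqP me; move: m1; rewrite me.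
rewrite leq_eqVlt => /predU1P[<- _|mn nN]; first by rewrite wm.
have i1 : (m <= n <= N)%N by rewrite -ltnS mn.
have w0 : 0 < w n by apply: IH; rewrite -ltnS mn leqW.
have [/andP[h1 h2] h3] := GH_a n i1.
have a0 : 0 < a n by lra.
by rewrite -(pmulr_rgt0 _ a0) wS// mulr_gt0//; lra.
Qed.

(** Since [x - b_n >= 2 a_n], the weighted increments [a_n (u_(n+1) - u_n)] of a
    positive increasing solution increase. *)
Lemma solution_increasing n : (m <= n <= N)%N -> 1 <= u n <= u n.+1.
Proof.
elim: n => [|n IH] /andP[].
  by rewrite leqn0 => /eqP me; move: m1; rewrite me.
rewrite leq_eqVlt => /predU1P[<- _|mn nN]; first by rewrite um umS lexx.
have i1 : (m <= n <= N)%N by rewrite -ltnS mn ltnW.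
have i2 : (m <= n.+1 <= N)%N by rewrite ltnW.
have /andP[u1 uS] := IH i1; rewrite (le_trans u1 uS)/=.
have [/andP[a1 a2] aS] := a_bnd n mn.
have a0 : 0 < a n.+1 by lra.
rewrite -(ler_pM2l a0) rec; last by apply: leq_trans m1 mn.
have [/andP[h4 h5] h6] := GH_a n.+1 i2.
have D2 : 2 * a n.+1 <= x - b n.+1.
  have s2 := GH_sum n.+1 i2; have q2 := GH_prod n.+1 i2.
  by have := sqr_ge0 (G n.+1 - H n.+1); nra.
have e1 : 2 * a n.+1 * u n.+1 <= (x - b n.+1) * u n.+1 by rewrite ler_wpM2r//; lra.
have e2 : a n * u n <= a n.+1 * u n.+1 by apply: ler_pM => //; lra.
lra.
Qed.

Lemma gauge_link n : (m <= n <= N)%N -> H n * w n.+1 = a n * w n.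
Proof.
move=> i1; have [/andP[h1 h2] h3] := GH_a n i1.
have [/andP[mn _] q1] := (i1, GH_prod n i1).
have a0 : 0 < a n by lra.
apply: (mulfI (lt0r_neq0 a0)).
by rewrite mulrCA wS// mulrA (mulrC (H n)) q1 mulrA.
Qed.

(** The Wronskian of [u] with the approximate solution [w] decreases. *)
Lemma solution_lower_bound n : G m <= 3 -> (m <= n <= N.+1)%N ->
  w n <= (1 + 6 * (n - m)%:R) * u n.
Proof.
move=> G3.
have W3 k : (m <= k <= N)%N -> a k * (u k * w k.+1 - u k.+1 * w k) <= 3.
  elim: k => [|k IH] /andP[].
    by rewrite leqn0 => /eqP me; move: m1; rewrite me.
  rewrite leq_eqVlt => /predU1P[<- mN|mk kN].
    have i1 : (m <= m <= N)%N by rewrite leqnn mN.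
    rewrite mulrBr mulrCA wS// wm um.
    have [/andP[h1 h2] h3] := GH_a m i1.
    have : 0 <= a m * (u m.+1 * 1) by rewrite mulr_ge0 ?mulr1; have := umS; lra.
    lra.
  have i1 : (m <= k <= N)%N by rewrite -ltnS mk ltnW.
  have i2 : (m <= k.+1 <= N)%N by rewrite ltnW.
  apply: le_trans (IH i1).
  have [_ HH] := characteristic_roots_mono k mk kN.
  have /andP[u1 _] := solution_increasing k.+1 i2.
  have w1 : 0 < w k.+1 by apply: gauge_gt0; rewrite ltnW// leqW.
  rewrite [leLHS](_ : _ = u k.+1 * (a k.+1 * w k.+2) - a k.+1 * u k.+2 * w k.+1); last by ring.
  rewrite wS// rec; last exact: leq_trans m1 mk.
  rewrite -(GH_sum k.+1 i2).
  rewrite [leRHS](_ : _ = a k * u k * w k.+1 - u k.+1 * (a k * w k)); last by ring.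
  rewrite -gauge_link//.
  have : 0 <= u k.+1 * w k.+1 * (H k.+1 - H k) by rewrite !mulr_ge0//; lra.
  lra.
elim: n => [|n IH] /andP[].
  by rewrite leqn0 => /eqP me; move: m1; rewrite me.
rewrite leq_eqVlt => /predU1P[<- _|mn nN].
  by rewrite wm um subnn mulr0 addr0 mulr1.
have i1 : (m <= n <= N)%N by rewrite -ltnS mn.
have i0 : (m <= n <= N.+1)%N by rewrite -ltnS mn leqW.
have {}IH := IH i0; have {W3} W3 := W3 n i1.
have /andP[u1 uS] := solution_increasing n i1.
rewrite (subSn (mn : (m <= n)%N)) -natr1.
set k := (n - m)%:R in IH *; have k0 : 0 <= k by [].
have u0 : 0 < u n by lra.
rewrite -(ler_pM2l u0).
have [/andP[a1 a2] aS] := a_bnd n mn.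
have e1 : u n * w n.+1 - u n.+1 * w n <= 6.
  have [le0|gt0] := leP (u n * w n.+1 - u n.+1 * w n) 0; first by lra.
  have : 0 <= (a n - 2^-1) * (u n * w n.+1 - u n.+1 * w n) by rewrite mulr_ge0//; lra.
  lra.
have e2 : u n.+1 * w n <= u n.+1 * ((1 + 6 * k) * u n) by rewrite ler_wpM2l//; lra.
have e3 : 1 * 1 <= u n * u n.+1 by apply: ler_pM => //; lra.
lra.
Qed.

(** With [y = u / w], the recurrence makes [G_n y_(n+1) - H_n y_n] decrease,
    which bounds the increments of [y]. *)
Lemma solution_upper_bound n B : u m.+1 <= B -> (m <= n <= N.+1)%N ->
  u n <= (1 + 2 * B * (n - m)%:R) * w n.
Proof.
move=> uB; pose y k := u k / w k.
have B1 : 1 <= B by have := umS; lra.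
have uE k : (m <= k <= N.+1)%N -> u k = y k * w k.
  by move=> ik; rewrite /y mulfVK// gt_eqF// gauge_gt0.
have y0 k : (m <= k <= N.+1)%N -> 0 <= y k.
  move=> ik; rewrite divr_ge0 ?(ltW (gauge_gt0 _ ik))//.
  have /andP[mk kN] := ik; case: k ik mk kN => [|k] ik mk kN.
    by move: (leq_trans m1 mk).
  move: mk; rewrite leq_eqVlt => /predU1P[<-|mk]; first by rewrite um.
  have : (m <= k <= N)%N by rewrite -ltnS mk.
  by move=> /solution_increasing/andP[]; lra.
have base : G m * y m.+1 - H m * y m <= B \/ (N < m)%N.
  have [Nm|mN] := ltnP N m; [by right|left].
  have i1 : (m <= m <= N)%N by rewrite leqnn mN.
  have i2 : (m <= m.+1 <= N.+1)%N by rewrite leqnSn.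
  have [/andP[h1 h2] h3] := GH_a m i1.
  have ym : y m = 1 by rewrite /y um wm divr1.
  have [/andP[a1 a2] aS] := a_bnd m (leqnn m).
  have : G m * y m.+1 = a m * u m.+1.
    have w1 := gauge_gt0 _ i2; apply: (mulIf (lt0r_neq0 w1)).
    by rewrite -mulrA -uE// -mulrA (mulrC (u _)) mulrA wS// wm mulr1.
  have : a m * u m.+1 <= 1 * B by apply: ler_pM => //; have := umS; lra.
  by rewrite ym; lra.
have FB k : (m <= k <= N)%N -> G k * y k.+1 - H k * y k <= B.
  elim: k => [|k IH] /andP[].
    by rewrite leqn0 => /eqP me; move: m1; rewrite me.
  rewrite leq_eqVlt => /predU1P[<- mN|mk kN].
    by case: base => //; rewrite ltnNge mN.
  have i1 : (m <= k <= N)%N by rewrite -ltnS mk ltnW.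
  have i2 : (m <= k.+1 <= N)%N by rewrite ltnW.
  have i3 : (m <= k.+2 <= N.+1)%N by rewrite leqW// ltnW.
  have i4 : (m <= k.+1 <= N.+1)%N by rewrite ltnW// leqW.
  have i5 : (m <= k <= N.+1)%N by rewrite -ltnS mk leqW// ltnW.
  apply: le_trans (IH i1).
  have [GG _] := characteristic_roots_mono k mk kN.
  have w1 := gauge_gt0 _ i4.
  have e1 : G k.+1 * y k.+2 = (G k.+1 + H k.+1) * y k.+1 - H k * y k.
    apply: (mulIf (lt0r_neq0 w1)).
    have := rec k (leq_trans m1 mk).
    rewrite -(GH_sum _ i2) (uE _ i3) (uE _ i4) (uE _ i5) => rk.
    have -> : G k.+1 * y k.+2 * w k.+1 = a k.+1 * (y k.+2 * w k.+2).
      by rewrite [RHS]mulrCA wS//; ring.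
    rewrite rk (mulrCA (a k)) -(gauge_link k i1). ring.
  rewrite e1 [leLHS](_ : _ = G k.+1 * y k.+1 - H k * y k); last by ring.
  by rewrite lerD2r ler_wpM2r// y0.
elim: n => [|n IH] /andP[].
  by rewrite leqn0 => /eqP me; move: m1; rewrite me.
rewrite leq_eqVlt => /predU1P[<- _|mn nN].
  by rewrite wm um subnn mulr0 addr0 mulr1.
have i1 : (m <= n <= N)%N by rewrite -ltnS mn.
have i0 : (m <= n <= N.+1)%N by rewrite -ltnS mn leqW.
have i2 : (m <= n.+1 <= N.+1)%N by rewrite ltnW.
have {}IH := IH i0; have {}FB := FB n i1; have yn := y0 n i0.
have [/andP[h1 h2] h3] := GH_a n i1; have [/andP[a1 a2] aS] := a_bnd n mn.
move: IH; rewrite (uE _ i0) (uE _ i2) !(ler_pM2r (gauge_gt0 _ _))//.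
rewrite (subSn (mn : (m <= n)%N)) -natr1; set k := (n - m)%:R => IH.
have : y n.+1 - y n <= 2 * B.
  have [le0|gt0] := leP (y n.+1 - y n) 0; first by lra.
  have : 0 <= (G n - 2^-1) * (y n.+1 - y n) by rewrite mulr_ge0//; lra.
  have : 0 <= (G n - H n) * y n by rewrite mulr_ge0//; lra.
  lra.
lra.
Qed.

End GrowthUpToTurningIndex.

(** * Eventually nonincreasing solutions at the edge are subordinate *)

Section ThreeTerm.
Context {R : realType} (a b : nat -> R) (x : R).
Context (a_gt0 : forall n, (1 <= n)%N -> 0 < a n).
Implicit Types u t : nat -> R.

Lemma wronskian_const u t : three_term a b x u -> three_term a b x t ->
  forall n, (1 <= n)%N ->
  a n * (u n * t n.+1 - u n.+1 * t n) = a 1%N * (u 1%N * t 2%N - u 2%N * t 1%N).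
Proof.
move=> ru rt; elim=> // n IH _; case: n IH => // n /(_ isT) <-.
rewrite mulrBr mulrCA rt// [X in _ - X = _](_ : _ = a n.+2 * u n.+3 * t n.+2); last by ring.
by rewrite ru//; ring.
Qed.

Lemma three_term_vanish u n : three_term a b x u -> (1 <= n)%N ->
  u n = 0 -> u n.+1 = 0 -> u 1%N = 0.
Proof.
move=> ru; elim: n => // n IH _; case: n IH => // n IH u1 u2.
apply: IH => //; have := ru n.+1 isT; rewrite u1 u2 !mulr0 sub0r => /eqP.
by rewrite eq_sym oppr_eq0 mulf_eq0 gt_eqF ?a_gt0//= => /eqP.
Qed.

Lemma three_term_multiple u t : three_term a b x u -> three_term a b x t ->
  u 1%N = 1 -> u 1%N * t 2%N - u 2%N * t 1%N = 0 ->
  forall n, (1 <= n)%N -> t n = t 1%N * u n.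
Proof.
move=> ru rt u1 W0.
suff main n : (1 <= n)%N -> t n = t 1%N * u n /\ t n.+1 = t 1%N * u n.+1.
  by move=> n n1; have [] := main n n1.
elim: n => // n IH _; case: n IH => [_|n /(_ isT) [e1 e2]].
  by rewrite u1 mulr1; split=> //; rewrite u1 in W0; lra.
split=> //; have an := a_gt0 n.+2 isT; apply: (mulfI (lt0r_neq0 an)).
by rewrite mulrCA (ru n.+1 isT) (rt n.+1 isT) e1 e2; ring.
Qed.

End ThreeTerm.

Section DecayingSolution.
Context {R : realType} (a b u : nat -> R).
Context (a_gt0 : forall n, (1 <= n)%N -> 0 < a n).
Context (rec : three_term a b 2 u) (u1 : u 1%N = 1) (k : nat) (k1 : (1 <= k)%N).
Context (edge : forall n, (k <= n)%N -> [/\ a n <= a n.+1, a n <= 1 & b n + 2 * a n <= 2]).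
Context (nogrowth : forall n, (k <= n)%N -> u n * u n.+1 <= u n ^+ 2).

(** The recurrence at the edge is convex: [u_n u_(n+1)] is bounded below by the
    next square if the step after it does not grow. *)
Lemma decay_step n : (k <= n)%N -> u n.+1 ^+ 2 <= u n * u n.+1.
Proof.
move=> kn; have n1 : (1 <= n)%N by exact: leq_trans k1 kn.
have [aS _ _] := edge n kn; have [_ _ e] := edge n.+1 (leqW kn).
have a0 := a_gt0 n n1; rewrite -(ler_pM2l a0).
have h1 : a n.+1 * (u n.+1 * u n.+2) <= a n.+1 * u n.+1 ^+ 2.
  by rewrite ler_pM2l ?a_gt0// nogrowth// leqW.
rewrite mulrCA rec// in h1.
have h2 : 0 <= (2 - b n.+1 - 2 * a n.+1) * u n.+1 ^+ 2.
  by rewrite mulr_ge0 ?sqr_ge0//; lra.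
have h3 : 0 <= (a n.+1 - a n) * u n.+1 ^+ 2 by rewrite mulr_ge0 ?sqr_ge0// subr_ge0.
lra.
Qed.

Lemma decay_neq0 n : (k <= n)%N -> u n != 0.
Proof.
move=> kn; apply/eqP => un0; have := decay_step n kn; rewrite un0 mul0r => h.
have uS0 : u n.+1 = 0.
  by apply/eqP; rewrite -(sqrf_eq0 (u n.+1)) eq_le h sqr_ge0.
have := three_term_vanish a b 2 a_gt0 u n rec (leq_trans k1 kn) un0 uS0.
by rewrite u1 => /eqP; rewrite oner_eq0.
Qed.

Lemma decay_prod n : (k <= n)%N -> 0 < u n * u n.+1.
Proof.
move=> kn; apply: lt_le_trans (decay_step n kn).
by rewrite exprn_even_gt0//= decay_neq0// leqW.
Qed.

Lemma decay_bounded n : (k <= n)%N -> u n ^+ 2 <= u k ^+ 2.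
Proof.
elim: n => [|n IH]; first by rewrite leqn0 => /eqP ->.
rewrite leq_eqVlt => /predU1P[->//|kn]; apply: le_trans (IH kn).
exact: le_trans (decay_step n kn) (nogrowth n kn).
Qed.

Section OtherSolution.
Context (t : nat -> R) (W : R) (W_neq0 : W != 0).
Context (W_eq : forall n, (1 <= n)%N ->
  a n * (u n * t n.+1 - u n.+1 * t n) = W).

Let uk0 : 0 < u k ^+ 2.
Proof. by rewrite exprn_even_gt0//= decay_neq0. Qed.

Let W2 : 0 < W ^+ 2.
Proof. by rewrite exprn_even_gt0. Qed.

(** [t / u] moves in one direction by at least [|W| / u_k^2] at each step. *)
Lemma ratio_growth n : (k <= n)%N ->
  W * (t k / u k) + (n - k)%:R * (W ^+ 2 / u k ^+ 2) <= W * (t n / u n).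
Proof.
elim: n => [|n IH].
  by rewrite leqn0 => /eqP ->; rewrite subnn mul0r addr0.
rewrite leq_eqVlt => /predU1P[->|kn]; first by rewrite subnn mul0r addr0.
rewrite (subSn (kn : (k <= n)%N)) -natr1 mulrDl mul1r addrA.
have un := decay_neq0 n kn; have uS := decay_neq0 n.+1 (leqW (kn : (k <= n)%N)).
have n1 : (1 <= n)%N by exact: leq_trans k1 kn.
have an := a_gt0 n n1.
have -> : W * (t n.+1 / u n.+1) = W * (t n / u n) + W ^+ 2 / (a n * (u n * u n.+1)).
  rewrite expr2 -{3}(W_eq n n1).
  by field; rewrite uS un gt_eqF.
apply: lerD; first exact: IH.
rewrite ler_pM2l// lef_pV2 ?posrE//; last by rewrite mulr_gt0// decay_prod.
have [_ a1 _] := edge n kn.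
rewrite -[leRHS]mul1r; apply: ler_pM => //; [exact: ltW|exact/ltW/decay_prod|].
exact: le_trans (nogrowth n kn) (decay_bounded n kn).
Qed.

Lemma small_wrt_other e : 0 < e ->
  exists2 n0, (k <= n0)%N & forall n, (n0 <= n)%N -> u n ^+ 2 <= e * t n ^+ 2.
Proof.
move=> e0; pose c := W ^+ 2 / u k ^+ 2.
have c0 : 0 < c by rewrite divr_gt0.
pose B := (`|W * (t k / u k)| + W ^+ 2 / e + 1) / c.
exists (k + (Num.truncn B).+1)%N; first exact: leq_addr.
move=> n n0n; have kn : (k <= n)%N by apply: leq_trans n0n; exact: leq_addr.
have un := decay_neq0 n kn.
have hB : B < (n - k)%:R.
  apply: lt_le_trans (Num.Theory.truncnS_gt B) _.
  by rewrite ler_nat leq_subRL.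
have h1 : W ^+ 2 / e + 1 <= W * (t n / u n).
  apply: le_trans (ratio_growth n kn); rewrite -/c.
  have : B * c <= (n - k)%:R * c by rewrite ler_wpM2r// ltW.
  rewrite /B divfK ?gt_eqF//.
  by have := ler_norm (- (W * (t k / u k))); rewrite normrN; lra.
set s := t n / u n in h1.
have tE : t n = s * u n by rewrite /s divfK.
have h2 : 0 < W ^+ 2 / e by rewrite divr_gt0.
have h3 : (W ^+ 2 / e + 1) ^+ 2 <= (W * s) ^+ 2.
  by rewrite ler_sqr ?nnegrE//; lra.
have h4 : W ^+ 2 / e <= W ^+ 2 * s ^+ 2.
  rewrite exprMn in h3; move: (W ^+ 2 / e) h2 h3 => A h2 h3.
  by have := sqr_ge0 A; lra.
have h5 : 1 <= e * s ^+ 2.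
  by move: h4; rewrite ler_pdivrMr// -mulrA ler_pMr// mulrC.
by rewrite tE exprMn mulrA -{1}[u n ^+ 2]mul1r ler_wpM2r// sqr_ge0.
Qed.

Definition sqsum (v : nat -> R) N := \sum_(1 <= n < N.+1) v n ^+ 2.

Lemma sqsum_split v n0 N : (n0 <= N)%N ->
  sqsum v N = sqsum v n0 + \sum_(n0.+1 <= n < N.+1) v n ^+ 2.
Proof. by move=> nN; rewrite /sqsum (@big_cat_nat _ _ _ n0.+1). Qed.

Lemma sqsum_mono v N N' : (N <= N')%N -> sqsum v N <= sqsum v N'.
Proof.
move=> NN; rewrite (sqsum_split v N N' NN) lerDl.
by rewrite sumr_ge0// => i _; rewrite sqr_ge0.
Qed.

(** By the Wronskian, [t_n^2 + t_(n+1)^2] is bounded away from [0] when [u] is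
    bounded. *)
Lemma sqsum_other_unbounded B : exists N0, forall N, (N0 <= N)%N -> B <= sqsum t N.
Proof.
pose c := W ^+ 2 / (2 * u k ^+ 2).
have c0 : 0 < c by rewrite divr_gt0// mulr_gt0.
have pairs n : (k <= n)%N -> c <= t n ^+ 2 + t n.+1 ^+ 2.
  move=> kn; have n1 : (1 <= n)%N by exact: leq_trans k1 kn.
  have den : 0 < 2 * u k ^+ 2 by rewrite mulr_gt0.
  rewrite ler_pdivrMr// -(W_eq n n1).
  have [_ a1 _] := edge n kn; have a0 := a_gt0 n n1.
  rewrite exprMn; set D := u n * t n.+1 - u n.+1 * t n.
  apply: (@le_trans _ _ (D ^+ 2)).
    by rewrite ler_piMl ?sqr_ge0// expr_le1// ltW.
  apply: (@le_trans _ _ ((u n ^+ 2 + u n.+1 ^+ 2) * (t n ^+ 2 + t n.+1 ^+ 2))).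
    by rewrite -subr_ge0 [leRHS](_ : _ = (u n * t n + u n.+1 * t n.+1) ^+ 2) ?sqr_ge0// /D; ring.
  rewrite mulrC ler_wpM2l ?addr_ge0 ?sqr_ge0//.
  by have := decay_bounded n kn; have := decay_bounded n.+1 (leqW kn); lra.
have grow j : j%:R * c <= sqsum t (k + j.*2)%N.
  elim: j => [|j IH]; first by rewrite mul0r sumr_ge0// => i _; rewrite sqr_ge0.
  rewrite -natr1 mulrDl mul1r doubleS !addnS /sqsum 2?big_nat_recr//= -addrA.
  apply: lerD; first exact: IH.
  by apply: (pairs (k + j.*2).+1); rewrite leqW// leq_addr.
exists (k + (Num.truncn (`|B| / c)).+1.*2)%N.
move=> N /(sqsum_mono t); apply: le_trans.
apply: le_trans (grow _); rewrite -ler_pdivrMr//.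
apply: le_trans (ltW (Num.Theory.truncnS_gt _)).
by rewrite ler_pM2r ?invr_gt0// ler_norm.
Qed.

Lemma sqsum_ratio e : 0 < e ->
  exists N0, forall N, (N0 <= N)%N -> 0 < sqsum t N /\ sqsum u N <= e * sqsum t N.
Proof.
move=> e0; have e2 : 0 < e / 2 by rewrite divr_gt0.
have [n0 kn0 hn0] := small_wrt_other (e / 2) e2.
have [N1 hN1] := sqsum_other_unbounded ((sqsum u n0 + 1) / (e / 2)).
exists (maxn n0 N1) => N; rewrite geq_max => /andP[n0N N1N].
have T := hN1 N N1N.
have su0 : 0 <= sqsum u n0 by rewrite sumr_ge0// => i _; rewrite sqr_ge0.
have T0 : 0 < (sqsum u n0 + 1) / (e / 2) by rewrite divr_gt0//; lra.
split; first exact: lt_le_trans T.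
have h1 : sqsum u N <= sqsum u n0 + e / 2 * sqsum t N.
  rewrite (sqsum_split u n0 N n0N) (sqsum_split t n0 N n0N) lerD2l mulrDr.
  rewrite -[leLHS]add0r; apply: lerD.
    rewrite mulr_ge0 ?(ltW e2)//.
    by rewrite sumr_ge0// => i _; rewrite sqr_ge0.
  rewrite mulr_sumr !big_nat; apply: ler_sum => i /andP[ni _].
  by apply: hn0; exact: ltnW.
move: T; rewrite ler_pdivrMr// => T; lra.
Qed.

End OtherSolution.

Lemma normc_sqr (z : R[i]) : Normc.normc z ^+ 2 = complex.Re z ^+ 2 + complex.Im z ^+ 2.
Proof.
by case: z => r i /=; rewrite sqr_sqrtr// addr_ge0 ?sqr_ge0.
Qed.

Lemma eigensolution_parts (v : nat -> R[i]) : eigensolution a b 2 v ->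
  three_term a b 2 (fun n => complex.Re (v n)) /\
  three_term a b 2 (fun n => complex.Im (v n)).
Proof.
move=> hv; split=> n n1; have := hv n.+1 n1;
  case: (v n) (v n.+1) (v n.+2) => [r0 i0] [r1 i1] [r2 i2] /=;
  rewrite /real_complex_def; simpc => -[] h1 h2; lra.
Qed.

Lemma sum_sq_ge (v : nat -> R[i]) N : sqsum (fun n => complex.Re (v n)) N <= sum_sq v N
  /\ sqsum (fun n => complex.Im (v n)) N <= sum_sq v N.
Proof.
by split; apply: ler_sum => i _; rewrite normc_sqr ?lerDl ?lerDr sqr_ge0.
Qed.

(** The coefficients are real, so the real and imaginary parts of a second
    solution are solutions, and one of them has a nonzero Wronskian with [u]. *)
Lemma decaying_subordinate : subordinate a b 2 (fun n => (u n)%:C%C).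
Proof.
split.
- move=> n; case: n => // n; case: n => // n _.
  have := rec n.+1 isT; rewrite /= /real_complex_def; simpc => h.
  by congr (_ +i* _)%C; lra.
- exists 1%N => //; rewrite u1; exact: oner_neq0.
move=> v hv nm.
have [rre rim] := eigensolution_parts v hv.
pose Wr t := a 1%N * (u 1%N * t 2%N - u 2%N * t 1%N).
have [t [rt Wt tv]] : exists t : nat -> R, [/\ three_term a b 2 t, Wr t != 0 &
    forall N, sqsum t N <= sum_sq v N].
  have [Wre|Wre] := eqVneq (Wr (fun n => complex.Re (v n))) 0; last first.
    by exists (fun n => complex.Re (v n)); split=> // N; have [] := sum_sq_ge v N.
  have [Wim|Wim] := eqVneq (Wr (fun n => complex.Im (v n))) 0; last first.
    by exists (fun n => complex.Im (v n)); split=> // N; have [] := sum_sq_ge v N.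
  exfalso; apply: nm; exists (v 1%N) => n n1.
  have W0 t : Wr t = 0 -> u 1%N * t 2%N - u 2%N * t 1%N = 0.
    by move=> /eqP; rewrite mulf_eq0 gt_eqF ?a_gt0//= => /eqP.
  have e1 := three_term_multiple a b 2 a_gt0 u _ rec rre u1 (W0 _ Wre) n n1.
  have e2 := three_term_multiple a b 2 a_gt0 u _ rec rim u1 (W0 _ Wim) n n1.
  move: e1 e2; case: (v n) (v 1%N) => [r i] [r1 i1] /= -> ->.
  by rewrite /real_complex_def; simpc.
have Weq := wronskian_const a b 2 u t rec rt.
have uE N : sum_sq (fun n => (u n)%:C%C) N = sqsum u N.
  by apply: eq_bigr => i _; rewrite normc_sqr /= expr0n addr0.
apply/cvgrPdist_le => e e0.
have [N0 hN0] := sqsum_ratio t (Wr t) Wt Weq e e0.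
near=> N; have NN : (N0 <= N)%N by near: N; exact: nbhs_infty_ge.
have [t0 ut] := hN0 N NN.
have v0 : 0 < sum_sq v N by exact: lt_le_trans (tv N).
rewrite sub0r normrN uE ger0_norm; last first.
  apply: divr_ge0; last exact: ltW.
  by rewrite sumr_ge0// => i _; rewrite sqr_ge0.
rewrite ler_pdivrMr//; apply: le_trans ut _.
by rewrite ler_wpM2l ?tv// ltW.
Unshelve. all: by end_near. Qed.

End DecayingSolution.

(** * The turning index and the estimates at a fixed point *)

Section EdgeAnalysis.
Context {R : realType}.
Implicit Types (a b u : nat -> R) (x : R).

Lemma ler_arccosh (y z : R) : 1 <= y -> y <= z -> arccosh y <= arccosh z.
Proof.
move=> y1 yz; have z1 := le_trans y1 yz.
have pos t : 1 <= t -> 0 < t + Num.sqrt (t ^+ 2 - 1).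
  by move=> t1; rewrite ltr_pwDl ?sqrtr_ge0// (lt_le_trans _ t1).
rewrite /arccosh ler_ln ?posrE ?pos// lerD// ler_wsqrtr// lerD2r.
by rewrite ler_sqr ?nnegrE//; lra.
Qed.

Lemma gamma_ge0 a b n x : 0 < a n -> b n + 2 * a n <= x -> 0 <= gamma a b n x.
Proof.
by move=> a0 h; apply: arccosh_ge0; rewrite ler_pdivlMr ?mulr_gt0//; lra.
Qed.

Lemma ler_gamma a b n x y : 0 < a n -> b n + 2 * a n <= x -> x <= y ->
  gamma a b n x <= gamma a b n y.
Proof.
move=> a0 h xy; apply: ler_arccosh.
  by rewrite ler_pdivlMr ?mulr_gt0//; lra.
by rewrite ler_pM2r ?invr_gt0 ?mulr_gt0//; lra.
Qed.

Lemma gamma_roots a b n x : 0 < a n -> b n + 2 * a n <= x ->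
  let G := a n * expR (gamma a b n x) in
  let H := a n * expR (- gamma a b n x) in
  [/\ G + H = x - b n, G * H = a n ^+ 2, 0 < H <= a n & a n <= G].
Proof.
move=> a0 h G H; have g0 := gamma_ge0 a b n x a0 h.
have y1 : 1 <= (x - b n) / (2 * a n) by rewrite ler_pdivlMr ?mulr_gt0//; lra.
split.
- rewrite /G /H -mulrDr -[expR _ + _](divfK (_ : 2 != 0))// cosh_arccosh//.
  by field; rewrite gt_eqF.
- by rewrite /G /H mulrACA -expRD subrr expR0 mulr1 expr2.
- rewrite mulr_gt0 ?expR_gt0//= -[leRHS]mulr1 ler_pM2l//.
  by rewrite -expR0 ler_expR oppr_le0.
- by rewrite -[leLHS]mulr1 ler_pM2l// -expR0 ler_expR.
Qed.


(** The recurrence, solved for its first or its last term, bounds the square of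
    each term by the squares of the next two or of the previous two. *)
Lemma turan_vs_square a b u x N : three_term a b x u -> (1 <= N)%N ->
  1 <= x <= 2 ->
  (forall n, (N <= n)%N -> 2^-1 <= a n <= 1 /\ - 2^-1 <= b n <= 0) ->
  0 < edge_gap a b x N.+2 -> u N ^+ 2 <= u N.+1 ^+ 2 ->
  edge_gap a b x N.+2 / 160 * u N.+1 ^+ 2 <= turan a b x u N.+2
    <= 120 * 120 * u N.+1 ^+ 2.
Proof.
move=> rec N1 /andP[x1 x2] bnd gap0 uN.
have [/andP[a0 a0'] /andP[b0 b0']] := bnd N (leqnn N).
have [/andP[a1 a1'] /andP[b1 b1']] := bnd N.+1 (leqnSn N).
have [/andP[a2 a2'] /andP[b2 b2']] := bnd N.+2 (leqW (leqnSn N)).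
have r1 := rec N N1; have r2 := rec N.+1 isT.
(* Cauchy-Schwarz for [c e - al' g], with [c^2 + al'^2 <= 10] *)
have sq al c d e g al' : 2^-1 <= al -> al <= 1 -> -3 <= c -> c <= 3 ->
    -1 <= al' -> al' <= 1 ->
    al * d = c * e - al' * g -> d ^+ 2 <= 40 * (e ^+ 2 + g ^+ 2) :> R.
  move=> al1 al2 c1 c2 al'1 al'2 h.
  have h1 : (al * d) ^+ 2 <= 10 * (e ^+ 2 + g ^+ 2).
    have c9 : 0 <= 9 - c ^+ 2 by nra.
    have al9 : 0 <= 1 - al' ^+ 2 by nra.
    apply: (@le_trans _ _ ((c ^+ 2 + al' ^+ 2) * (e ^+ 2 + g ^+ 2))).
      by rewrite h -subr_ge0 [leRHS](_ : _ = (c * g + al' * e) ^+ 2) ?sqr_ge0//; ring.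
    by rewrite ler_wpM2r ?addr_ge0 ?sqr_ge0//; lra.
  have : 0 <= (al ^+ 2 - 4^-1) * d ^+ 2.
    by rewrite mulr_ge0 ?sqr_ge0//; nra.
  by rewrite exprMn in h1; lra.
have s1 : u N.+2 ^+ 2 <= 40 * (u N.+1 ^+ 2 + u N ^+ 2).
  by apply: sq r1; lra.
have s2 : u N.+3 ^+ 2 <= 40 * (u N.+2 ^+ 2 + u N.+1 ^+ 2).
  by apply: sq r2; lra.
have s3 : u N.+1 ^+ 2 <= 40 * (u N.+2 ^+ 2 + u N.+3 ^+ 2).
  by apply: (sq (a N.+1) (x - b N.+2) _ _ _ (a N.+2)); lra.
apply/andP; split.
  have a20 : 0 <= a N.+2 by lra.
  have bx : b N.+2 <= x by lra.
  apply: le_trans (turan_ge a b x u N.+2 a20 bx).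
  set k := edge_gap _ _ _ _ in gap0 *.
  have e1 : k * u N.+1 ^+ 2 <= k * (40 * (u N.+2 ^+ 2 + u N.+3 ^+ 2)).
    by rewrite ler_pM2l.
  have e2 : 0 <= (a N.+2 - 2^-1) * (k * (u N.+2 ^+ 2 + u N.+3 ^+ 2)).
    apply: mulr_ge0; first by lra.
    by rewrite mulr_ge0 ?(ltW gap0)// addr_ge0 ?sqr_ge0.
  lra.
rewrite /turan; set S := u N.+2 ^+ 2 + u N.+3 ^+ 2.
have S0 : 0 <= S by rewrite addr_ge0 ?sqr_ge0.
have e1 : 0 <= (1 - a N.+2 ^+ 2) * S by rewrite mulr_ge0//; nra.
have e2 : - ((x - b N.+2) * a N.+2 * u N.+2 * u N.+3) <= 3 * S.
  have c3 : (x - b N.+2) * a N.+2 <= 3 by nra.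
  have c0 : 0 <= (x - b N.+2) * a N.+2 by rewrite mulr_ge0//; lra.
  move: c3 c0; set c := (x - b N.+2) * a N.+2 => c3 c0.
  have : 0 <= c * (u N.+2 + u N.+3) ^+ 2 by rewrite mulr_ge0 ?sqr_ge0.
  have : 0 <= (3 - c) * S by rewrite mulr_ge0//; lra.
  have : 0 <= c * S by rewrite mulr_ge0.
  rewrite /S; lra.
have e3 : S <= 60 * 60 * u N.+1 ^+ 2 by rewrite /S; lra.
lra.
Qed.

Lemma nondecreasing_from_le_lim (v : nat -> R) N0 l :
  (forall n, (N0 <= n)%N -> v n <= v n.+1) -> v n @[n --> \oo] --> l ->
  forall n k, (N0 <= n)%N -> (n <= k)%N -> v n <= v k <= l.
Proof.
move=> vS vl.
have mono n k : (N0 <= n)%N -> (n <= k)%N -> v n <= v k.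
  move=> Nn; elim: k => [|k IH]; first by rewrite leqn0 => /eqP ->.
  rewrite leq_eqVlt => /predU1P[->//|nk]; apply: le_trans (IH nk) (vS k _).
  exact: leq_trans Nn nk.
move=> n k Nn nk; rewrite mono//= -(cvg_lim _ vl)//.
apply: limr_ge; first by apply/cvg_ex; exists l.
near=> j; apply: mono; first exact: leq_trans nk.
by near: j; exact: nbhs_infty_ge.
Unshelve. all: by end_near. Qed.

Lemma turning_index_spec a b x N0 : (1 <= N0)%N -> b N0 + 2 * a N0 <= x ->
  (exists K, forall n, (K <= n)%N -> x < b n + 2 * a n) ->
  let N := turning_index a b x in
  [/\ (1 <= N)%N, b N + 2 * a N <= x &
      forall k, (1 <= k)%N -> b k + 2 * a k <= x -> (k <= N)%N].
Proof.
move=> N1 hN [K hK] N; pose P n := (1 <= n)%N && (b n + 2 * a n <= x).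
have exP : exists n, P n by exists N0; rewrite /P N1.
have bndP n : P n -> (n <= K)%N.
  move=> /andP[_ h]; rewrite leqNgt; apply/negP => /ltnW/hK; lra.
case: (ex_maxnP exP bndP) => i /andP[i1 hi] imax.
have : [set n | [/\ (1 <= n)%N, b n + 2 * a n <= x & forall m, (1 <= m)%N ->
  b m + 2 * a m <= x -> (m <= n)%N]] i.
  by split=> // k k1 hk; apply: imax; rewrite /P k1.
by move/xgetI => /(_ 0%N).
Qed.


(** Here [E] is [e^h], and [ln w] the sum of the [gamma_j] up to a bounded
    part. *)
Lemma ln_estimate (fx w E K1 K2 : R) : 0 < fx -> 0 < w -> 0 < E -> 0 < K1 ->
  0 < K2 -> fx * w ^+ 2 <= K1 * E ^+ 2 -> 1 <= K2 * (fx * w ^+ 2) * E ^+ 2 ->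
  `|ln fx + 2 * ln w| <= 2 * ln E + (`|ln K1| + `|ln K2|).
Proof.
move=> f0 w0 E0 K10 K20 h1 h2.
have ln2 t : 0 < t -> ln (t ^+ 2) = 2 * ln t :> R.
  by move=> t0; rewrite expr2 lnM ?posrE//; ring.
have fw : 0 < fx * w ^+ 2 by rewrite mulr_gt0// exprn_gt0.
have E2 : 0 < E ^+ 2 by rewrite exprn_gt0.
have -> : ln fx + 2 * ln w = ln (fx * w ^+ 2).
  by rewrite lnM ?posrE ?exprn_gt0// ln2.
have e1 : ln (fx * w ^+ 2) <= ln K1 + 2 * ln E.
  by rewrite -ln2// -lnM ?posrE// ler_ln ?posrE ?mulr_gt0.
have e2 : 0 <= ln K2 + ln (fx * w ^+ 2) + 2 * ln E.
  rewrite -ln2// -!lnM ?posrE ?mulr_gt0// -ln1 ler_ln ?posrE ?mulr_gt0//.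
have := ler_norm (ln K1); have := ler_norm (ln K2).
have := normr_ge0 (ln K1); have := normr_ge0 (ln K2).
by rewrite ler_norml; move=> *; apply/andP; split; lra.
Qed.

Lemma semicircle_edge x : 1 <= x <= 2 ->
  Num.sqrt (2 - x) / 8 <= semicircle x <= Num.sqrt (2 - x).
Proof.
move=> /andP[x1 x2]; rewrite /semicircle.
have -> : 4 - x ^+ 2 = (2 - x) * (2 + x) by ring.
rewrite sqrtrM; last by lra.
have s0 := sqrtr_ge0 (2 - x).
have sl : 1 <= Num.sqrt (2 + x).
  by rewrite -[leLHS](sqrtr1 R) ler_wsqrtr//; lra.
have sh : Num.sqrt (2 + x) <= 2.
  rewrite -[leRHS]ger0_norm// -sqrtr_sqr ler_wsqrtr//; lra.
have p2 := pi_ge2 R; have p4 : pi <= 4 :> R by have := pihalf_lt2 R; lra.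
have p0 : 0 < 2 * pi :> R by lra.
rewrite ler_pdivlMr// ler_pdivrMr//.
apply/andP; split; nra.
Qed.

End EdgeAnalysis.

Lemma jacobi_three_term (R : realType) (p : nat -> {poly R}) (a b : nat -> R) x :
  jacobi_parameters p a b -> three_term a b x (fun n => (p n.-1).[x]).
Proof.
move=> pj [//|k] _ /=; have /(congr1 (fun q => q.[x])) := pj k.+1.
by rewrite mulrC hornerMX !hornerE => h; lra.
Qed.

Section GrowthAtTurningIndex.
Context {R : realType} (a b : nat -> R) (x : R) (m : nat) (m1 : (1 <= m)%N).
Context (bnd : forall n, (m <= n)%N -> 2^-1 <= a n <= 1 /\ - 2^-1 <= b n <= 0).
Context (mono : forall n, (m <= n)%N -> a n <= a n.+1 /\ b n <= b n.+1).
Context (x12 : 1 <= x < 2).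

(** The solution is normalized to be [1] at [m]; [q], [Q] and [B] carry the
    bounds on its first two values, which will be uniform in [x]. *)
Lemma growth_at_turning_index (U : nat -> R) N (B q Q : R) :
  three_term a b x U -> (m <= N)%N -> b N + 2 * a N <= x ->
  0 < q -> q <= U m ^+ 2 <= Q ->
  U m ^+ 2 <= U m * U m.+1 <= B * U m ^+ 2 ->
  let w := expR (\sum_(m <= j < N.+1) gamma a b j x) in
  [/\ U N ^+ 2 <= U N.+1 ^+ 2, q * w ^+ 2 <= 49 * N%:R ^+ 2 * U N.+1 ^+ 2 &
    U N.+1 ^+ 2 <= Q * (1 + 2 * B) ^+ 2 * (N%:R ^+ 2 * w ^+ 2)].
Proof.
move=> rec mN xlo q0 /andP[qlo Qhi] /andP[ulo uhi] w.
have [x1 x2] : 1 <= x /\ x < 2 by have /andP[] := x12.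
have um0 : U m != 0.
  by apply/eqP => h; move: qlo; rewrite h expr0n/=; lra.
have um2 : 0 < U m ^+ 2 by exact: lt_le_trans qlo.
pose v n := U n / U m.
have vE n : U n = v n * U m by rewrite /v divfK.
have recv : three_term a b x v.
  move=> n n1; apply: (mulIf um0); rewrite -mulrA -vE.
  have -> : a n.+1 * U n.+2 = (x - b n.+1) * U n.+1 - a n * U n by exact: rec.
  by rewrite (vE n.+1) (vE n); ring.
have vm : v m = 1 by rewrite /v divff.
have vS : v m.+1 = U m * U m.+1 / U m ^+ 2 by rewrite /v; field.
have vmS : 1 <= v m.+1 <= B.
  rewrite vS ler_pdivlMr// ler_pdivrMr// mul1r ulo; exact: uhi.
have /andP[v1 vB] := vmS.
pose G n := a n * expR (gamma a b n x).
pose H n := a n * expR (- gamma a b n x).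
pose W n := expR (\sum_(m <= j < n) gamma a b j x).
have a_pos n : (m <= n)%N -> 0 < a n.
  by move=> mn; have [/andP[? ?] _] := bnd n mn; lra.
have edge_mono n k : (m <= n)%N -> (n <= k)%N -> b n + 2 * a n <= b k + 2 * a k.
  move=> mn; elim: k => [|k IH]; first by rewrite leqn0 => /eqP ->.
  rewrite leq_eqVlt => /predU1P[->//|nk]; apply: le_trans (IH nk) _.
  by have [? ?] := mono k (leq_trans mn nk); lra.
have below n : (m <= n <= N)%N -> b n + 2 * a n <= x.
  by move=> /andP[mn nN]; apply: le_trans (edge_mono n N mn nN) xlo.
have roots n : (m <= n <= N)%N ->
    [/\ G n + H n = x - b n, G n * H n = a n ^+ 2, 0 < H n <= a n & a n <= G n].
  move=> i; apply: gamma_roots; last exact: below.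
  by apply: a_pos; have /andP[] := i.
have a_bnd n : (m <= n)%N -> 2^-1 <= a n <= 1 /\ a n <= a n.+1.
  by move=> mn; have [-> _] := bnd n mn; have [-> _] := mono n mn.
have GHs n : (m <= n <= N)%N -> G n + H n = x - b n by move=> /roots[].
have GHp n : (m <= n <= N)%N -> G n * H n = a n ^+ 2 by move=> /roots[].
have GHa n : (m <= n <= N)%N -> 0 < H n <= a n /\ a n <= G n by move=> /roots[].
have b_mn n : (m <= n)%N -> b n <= b n.+1 by move=> mn; have [] := mono n mn.
have Wm : W m = 1 by rewrite /W big_geq// expR0.
have WS n : (m <= n <= N)%N -> a n * W n.+1 = G n * W n.
  by move=> /andP[mn _]; rewrite /W big_nat_recr//= expRD /G; ring.
have mNN : (m <= N.+1 <= N.+1)%N by rewrite leqW// leqnn.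
have mNi : (m <= N <= N)%N by rewrite mN leqnn.
have mmi : (m <= m <= N)%N by rewrite leqnn.
have G3 : G m <= 3.
  have := GHs m mmi; have [/andP[? ?] ?] := GHa m mmi.
  by have [_ /andP[? ?]] := bnd m (leqnn m); lra.
have low := solution_lower_bound a b v W G H x m N recv m1 a_bnd GHs GHp GHa b_mn Wm WS
  vm v1 N.+1 G3 mNN.
have up := solution_upper_bound a b v W G H x m N recv m1 a_bnd GHs GHp GHa b_mn Wm WS
  vm v1 N.+1 B vB mNN.
have /andP[vN vNS] := solution_increasing a b v G H x m N recv m1 a_bnd GHs GHp GHa
  vm v1 N mNi.
have N1 : (1 <= N)%N by exact: leq_trans m1 mN.
have n1 : 1 <= N%:R :> R by rewrite ler1n.
have nmN : (N.+1 - m)%:R <= N%:R :> R by rewrite ler_nat leq_subLR -addn1 addnC leq_add2r.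
have w0 : 0 < w by exact: expR_gt0.
have nm0 : 0 <= (N.+1 - m)%:R :> R by [].
rewrite -[W N.+1]/w in low up.
set V := v N.+1 in low up vNS.
have V1 : 1 <= V by lra.
have low' : w <= 7 * N%:R * V.
  apply: le_trans low _; rewrite ler_wpM2r//; lra.
have up' : V <= (1 + 2 * B) * N%:R * w.
  apply: le_trans up _; rewrite ler_wpM2r//; first exact: ltW.
  have : 2 * B * (N.+1 - m)%:R <= 2 * B * N%:R by rewrite ler_wpM2l//; lra.
  lra.
have XE : U N.+1 ^+ 2 = U m ^+ 2 * V ^+ 2 by rewrite vE exprMn mulrC.
have uNS : U N ^+ 2 <= U N.+1 ^+ 2.
  have e n : U n ^+ 2 = v n ^+ 2 * U m ^+ 2 by rewrite (vE n) exprMn.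
  rewrite (e N) (e N.+1) -/V ler_pM2r// ler_sqr ?nnegrE//; lra.
have N0 : 0 < N%:R :> R by lra.
have w2 : 0 < w ^+ 2 by exact: exprn_gt0.
have Xlow : q * w ^+ 2 <= 49 * N%:R ^+ 2 * U N.+1 ^+ 2.
  rewrite XE.
  have e1 : w ^+ 2 <= (7 * N%:R * V) ^+ 2.
    have p7 : 0 <= 7 * N%:R * V by apply: mulr_ge0; [rewrite mulr_ge0|lra].
    by rewrite ler_sqr ?nnegrE ?(ltW w0).
  apply: (@le_trans _ _ (U m ^+ 2 * (7 * N%:R * V) ^+ 2)).
    by apply: ler_pM; rewrite ?sqr_ge0 ?(ltW q0).
  by rewrite le_eqVlt; apply/orP; left; apply/eqP; ring.
have Xup : U N.+1 ^+ 2 <= Q * (1 + 2 * B) ^+ 2 * (N%:R ^+ 2 * w ^+ 2).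
  rewrite XE.
  have e1 : V ^+ 2 <= ((1 + 2 * B) * N%:R * w) ^+ 2.
    by rewrite ler_sqr ?nnegrE//; lra.
  apply: (@le_trans _ _ (Q * ((1 + 2 * B) * N%:R * w) ^+ 2)).
    by apply: ler_pM => //; rewrite sqr_ge0.
  by rewrite le_eqVlt; apply/orP; left; apply/eqP; ring.
by split.
Qed.

End GrowthAtTurningIndex.

(** [E^2] is [n^2 s^2 / D^2].  The hypotheses bound [fx w^2] by a multiple of
    [n^2 s / D], and its inverse by a multiple of [n^2 s^3 / D^2]; both are at
    most multiples of [E^2] because [D <= s^2 <= s <= 1]. *)
Lemma edge_arithmetic (R : realType) (fx sx A X k D s n w E q K : R) :
  0 < fx -> 0 < q -> 0 < A -> 0 < D -> 0 < s -> s <= 1 -> 0 < n -> 0 < w ->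
  0 <= K -> D <= k -> k <= s ^+ 2 -> D * E = n * s ->
  s / 8 <= sx <= s ->
  k / 160 * X <= A <= 120 * 120 * X ->
  sx <= 32 * A * (s ^+ 2 / k) ^+ 2 * fx -> A * fx <= 64 * sx ->
  q * w ^+ 2 <= 49 * n ^+ 2 * X -> X <= K * (n ^+ 2 * w ^+ 2) ->
  fx * w ^+ 2 <= (64 * 160 * 49) / q * E ^+ 2 /\
  1 <= 256 * (120 * 120) * K * (fx * w ^+ 2) * E ^+ 2.
Proof.
move=> f0 q0 A0 D0 s0 s1 n0 w0 K0 Dk ks DE /andP[sl sh] /andP[A1 A2] u1 u2 Xl Xu.
have D2 : 0 < D ^+ 2 by exact: exprn_gt0.
have w2 : 0 < w ^+ 2 by exact: exprn_gt0.
have n2 : 0 < n ^+ 2 by exact: exprn_gt0.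
have X0 : 0 < X.
  have : 0 < 120 * 120 * X by exact: lt_le_trans A2.
  by rewrite pmulr_rgt0// mulr_gt0.
have k0 : 0 < k by exact: lt_le_trans Dk.
have ss : s ^+ 2 <= s by rewrite expr2 ler_piMl// ltW.
have Ds : D <= s by lra.
split.
- have e1 : D * X * fx <= 64 * 160 * s.
    have h1 : D * X <= k * X by rewrite ler_pM2r.
    have h2 : D * X * fx <= 160 * A * fx by rewrite ler_pM2r//; lra.
    lra.
  have e2 : q * w ^+ 2 * (D * fx) <= 49 * n ^+ 2 * X * (D * fx).
    by rewrite ler_pM2r ?mulr_gt0.
  have e3 : n ^+ 2 * (D * X * fx) <= n ^+ 2 * (64 * 160 * s) by rewrite ler_pM2l.
  have e4 : q * (fx * w ^+ 2) * D <= 64 * 160 * 49 * (n ^+ 2 * s) by lra.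
  have e5 : q * (fx * w ^+ 2) * D * D <= 64 * 160 * 49 * (n ^+ 2 * s) * s.
    apply: ler_pM => //; last exact: ltW.
    by apply/ltW/mulr_gt0 => //; apply: mulr_gt0 => //; exact: mulr_gt0.
  rewrite mulrAC ler_pdivlMr// -(ler_pM2r D2).
  rewrite [leRHS](_ : _ = 64 * 160 * 49 * (D * E) ^+ 2); last by ring.
  rewrite DE; lra.
- have e2 : (s ^+ 2 / k) ^+ 2 <= (s ^+ 2 / D) ^+ 2.
    rewrite ler_sqr ?nnegrE ?divr_ge0 ?sqr_ge0 ?(ltW D0) ?(ltW k0)//.
    by rewrite ler_pM2l ?exprn_gt0// lef_pV2 ?posrE.
  have e3 : s / 8 <= 32 * A * (s ^+ 2 / D) ^+ 2 * fx.
    apply: le_trans sl (le_trans u1 _); rewrite ler_pM2r// ler_pM2l//.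
    exact: mulr_gt0.
  have e4 : s * D ^+ 2 <= 256 * A * (s ^+ 2) ^+ 2 * fx.
    move: e3; rewrite expr_div_n -(ler_pM2r D2).
    rewrite [leRHS](_ : _ = 32 * A * (s ^+ 2) ^+ 2 * fx); last by field; rewrite gt_eqF.
    lra.
  have e5 : A <= 120 * 120 * (K * (n ^+ 2 * w ^+ 2)) by lra.
  have s2 : 0 < s ^+ 2 by exact: exprn_gt0.
  have e6 : s * D ^+ 2 <= 256 * (120 * 120) * K * (fx * w ^+ 2) * (n * s) ^+ 2 * s ^+ 2.
    apply: le_trans e4 _.
    have h : 0 < (s ^+ 2) ^+ 2 * fx by rewrite mulr_gt0// exprn_gt0.
    have : A * ((s ^+ 2) ^+ 2 * fx)
        <= 120 * 120 * (K * (n ^+ 2 * w ^+ 2)) * ((s ^+ 2) ^+ 2 * fx).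
      by rewrite ler_pM2r.
    lra.
  have sD : 0 < s * D ^+ 2 by rewrite mulr_gt0.
  rewrite -(ler_pM2r sD) mul1r; apply: le_trans e6 _.
  rewrite [leRHS](_ : _ = 256 * (120 * 120) * K * (fx * w ^+ 2) * (D * E) ^+ 2 * s);
    last by ring.
  rewrite DE; apply: ler_wpM2l; last exact: ss.
  apply: mulr_ge0; last exact: sqr_ge0.
  apply: mulr_ge0; last by apply/ltW/mulr_gt0.
  apply: mulr_ge0; last exact: K0.
  by apply: mulr_ge0; [|apply: mulr_ge0]; exact: ler0n.
Qed.

Section EdgeEstimate.
Context {R : realType} (mu : probability (measurableTypeR R) R) (M : R).
Context (M_ge2 : 2 <= M) (mu_supp : mu (~` `[- M, M]%classic) = 0%E).
Context (p : nat -> {poly R}) (p_orthonormal : orthonormal_polynomials mu p).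
Context (a b : nat -> R) (p_jacobi : jacobi_parameters p a b).
Context (a_lim : a n @[n --> \oo] --> (1 : R)).
Context (b_lim : b n @[n --> \oo] --> (0 : R)).
Context (f : R -> R) (f_density : ac_density mu f).
Context (m : nat) (m1 : (1 <= m)%N).
Context (bnd : forall n, (m <= n)%N -> 2^-1 <= a n <= 1 /\ - 2^-1 <= b n <= 0).
Context (mono : forall n, (m <= n)%N -> a n <= a n.+1 /\ b n <= b n.+1).
Context (x : R) (x12 : 1 <= x < 2).
Local Notation u y := (fun n => (p n.-1).[y]).

(** Past the turning index the Turan determinants at [x] stay comparable with
    their value there, uniformly near [x]. *)
Lemma density_vs_turan N : (m <= N)%N -> {for x, continuous f} -> 0 < f x ->
  0 < edge_gap a b x N -> 0 < turan a b x (u x) N ->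
  semicircle x <= 32 * turan a b x (u x) N * ((2 - x) / edge_gap a b x N) ^+ 2 * f x
  /\ turan a b x (u x) N * f x <= 64 * semicircle x.
Proof.
move=> mN cf f0 gap0 A0; set A := turan _ _ _ _ _ in A0 *.
have [x1 x2] : 1 <= x /\ x < 2 by have /andP[] := x12.
have N1 : (1 <= N)%N by exact: leq_trans m1 mN.
pose g y := turan a b y (u y) N * ((2 - y) / edge_gap a b y N) ^+ 2.
have cA : {for x, continuous (fun y => turan a b y (u y) N)}.
  rewrite (_ : (fun y => _) = horner (turan_poly a b p N.-1)).
    exact: continuous_horner.
  by apply/funext => y; rewrite horner_turan_poly prednK.
have ck : {for x, continuous (fun y : R => edge_gap a b y N : R)}.
  by apply: cvgB; [exact: cvg_cst|exact: cvg_id].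
have cq : {for x, continuous (fun y : R => ((2 - y) / edge_gap a b y N : R))}.
  apply: cvgM; first by apply: cvgB; [exact: cvg_cst|exact: cvg_id].
  by apply: cvgV; rewrite ?gt_eqF.
have cg : {for x, continuous g} by exact: cvgM cA (cvgM cq cq).
have gx0 : 0 < g x.
  by rewrite mulr_gt0// exprn_gt0// divr_gt0//; lra.
(* the factor [2], and the [A / 2] below, leave room for points near [x] *)
pose U := 2 * g x.
have : \forall y \near x, [/\ 0 <= y, 0 < edge_gap a b y N,
    A / 2 <= turan a b y (u y) N & g y <= U].
  near=> y; split.
  - near: y; apply: (cvgr_ge x); [exact: cvg_id|lra].
  - near: y; apply: (cvgr_gt _ ck); exact: gap0.
  - near: y; apply: (cvgr_ge _ cA); rewrite -/A; lra.
  - near: y; apply: (cvgr_le _ cg); rewrite /U; lra.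
move=> /nbhs_ballP[d /= d0 hd].
have := density_bounds mu M M_ge2 mu_supp p p_orthonormal a b p_jacobi a_lim b_lim
  f f_density x (A / 4) U d.
have -> : -2 < x < 2 by apply/andP; split; lra.
move=> /(_ isT cf f0 (divr_gt0 A0 _) d0) [//| |s1 s2].
  near=> n => y yx.
  have [y0 gy Ay gU] : [/\ 0 <= y, 0 < edge_gap a b y N,
    A / 2 <= turan a b y (u y) N & g y <= U].
    by apply: hd; rewrite /ball/= distrC.
  have Nn : (N <= n.+1)%N by rewrite leqW//; near: n; exact: nbhs_infty_ge.
  have rec := jacobi_three_term R p a b y p_jacobi.
  have /andP[l1 l2] := turan_tail_bounds a b (u y) y N rec N1 y0
    (fun n mn => mono n (leq_trans mN mn)) (fun n mn => bnd n (leq_trans mN mn)) gy n.+1 Nn.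
  rewrite horner_turan_poly; apply/andP; split; first by lra.
  exact: le_trans l2 gU.
split; last by lra.
by apply: le_trans s1 _; rewrite /U /g -/A; lra.
Unshelve. all: by end_near. Qed.

(** The constants depend only on [q], [Q] and [B], hence not on [x]. *)
Lemma edge_estimate N (B q Q : R) : (m <= N)%N ->
  {for x, continuous f} -> 0 < f x -> 0 < q -> 
  b N + 2 * a N <= x -> x < b N.+1 + 2 * a N.+1 ->
  q <= u x m ^+ 2 <= Q ->
  u x m ^+ 2 <= u x m * u x m.+1 <= B * u x m ^+ 2 ->
  let D := b N.+2 - b N.+1 + a N.+2 - a N.+1 in
  let E := N%:R * D^-1 * Num.sqrt (2 - x) in
  let w := expR (\sum_(m <= j < N.+1) gamma a b j x) in
  0 < D ->
  [/\ 0 < E, f x * w ^+ 2 <= (64 * 160 * 49) / q * E ^+ 2 &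
    1 <= (256 * (120 * 120)) * (Q * (1 + 2 * B) ^+ 2) * (f x * w ^+ 2) * E ^+ 2].
Proof.
move=> mN cf f0 q0 xlo xhi qQ uB D E w D0.
have [x1 x2] : 1 <= x /\ x < 2 by have /andP[] := x12.
have rec := jacobi_three_term R p a b x p_jacobi.
pose U n := (p n.-1).[x].
have [uNS Xlow Xup] := growth_at_turning_index a b x m m1 bnd mono x12 U N B q Q
  rec mN xlo q0 qQ uB.
have N1 : (1 <= N)%N by exact: leq_trans m1 mN.
have bndN n : (N <= n)%N -> 2^-1 <= a n <= 1 /\ - 2^-1 <= b n <= 0.
  by move=> Nn; apply: bnd; exact: leq_trans Nn.
have [aN bN] := mono N.+1 (leqW mN).
have gapD : D <= edge_gap a b x N.+2 by rewrite /D /edge_gap; lra.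
have gap0 : 0 < edge_gap a b x N.+2 by exact: lt_le_trans gapD.
have gap2 : edge_gap a b x N.+2 <= 2 - x.
  by have [/andP[? ?] /andP[? ?]] := bndN N.+2 (leqW (leqnSn N)); rewrite /edge_gap; lra.
have x12' : 1 <= x <= 2 by rewrite x1 ltW.
have AX := turan_vs_square a b U x N rec N1 x12' bndN gap0 uNS.
have n0 : 0 < N%:R :> R by rewrite ltr0n.
have w0 : 0 < w by exact: expR_gt0.
have X0 : 0 < U N.+1 ^+ 2.
  rewrite -(pmulr_rgt0 _ (_ : 0 < 49 * N%:R ^+ 2)); last by rewrite mulr_gt0// exprn_gt0.
  by apply: lt_le_trans Xlow; rewrite mulr_gt0// exprn_gt0.
have A0 : 0 < turan a b x U N.+2.
  by have /andP[A1 _] := AX; apply: lt_le_trans A1; rewrite mulr_gt0// divr_gt0.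
have [s1 s2] := density_vs_turan N.+2 (leqW (leqW mN)) cf f0 gap0 A0.
have d0 : 0 < 2 - x by lra.
have s0 : 0 < Num.sqrt (2 - x) by rewrite sqrtr_gt0.
have ss : 2 - x = Num.sqrt (2 - x) ^+ 2 by rewrite sqr_sqrtr// ltW.
have sle1 : Num.sqrt (2 - x) <= 1 by rewrite -[leRHS](sqrtr1 R) ler_wsqrtr//; lra.
have DE : D * E = N%:R * Num.sqrt (2 - x) by rewrite /E; field; rewrite gt_eqF.
have K0 : 0 <= Q * (1 + 2 * B) ^+ 2.
  by rewrite mulr_ge0 ?sqr_ge0//; have /andP[] := qQ; lra.
rewrite {1}ss in s1; rewrite ss in gap2.
have [r1 r2] := edge_arithmetic R (f x) (semicircle x) (turan a b x U N.+2) (U N.+1 ^+ 2)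
  (edge_gap a b x N.+2) D (Num.sqrt (2 - x)) N%:R w E q (Q * (1 + 2 * B) ^+ 2)
  f0 q0 A0 D0 s0 sle1 n0 w0 K0 gapD gap2 DE (semicircle_edge x x12') AX s1 s2 Xlow Xup.
by split=> //; rewrite /E !mulr_gt0// invr_gt0.
Qed.

End EdgeEstimate.

(** * The neighbourhood of the edge *)

Lemma compact_support_itv (R : realType) (mu : probability (measurableTypeR R) R) :
  compactly_supported mu -> exists2 M : R, 2 <= M & mu (~` `[- M, M]%classic) = 0%E.
Proof.
move=> [K cK muK]; have [B [_ hB]] := compact_bounded cK.
pose M := `|B| + 2; have M2 : 2 <= M by rewrite lerDr.
exists M => //; apply/eqP; rewrite eq_le measure_ge0 andbT -muK.
have mK : measurable (K : set (measurableTypeR R)) by exact: compact_measurable.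
have mI : measurable (`[- M, M]%classic : set (measurableTypeR R)) by exact: measurable_itv.
apply: le_measure; rewrite ?inE; [exact: measurableC..|].
apply: subsetC => x Kx; rewrite /= in_itv/= -ler_norml.
by apply: (hB M) => //; rewrite /M; have := ler_norm B; lra.
Qed.

Lemma growing_index (R : realType) (p : nat -> {poly R}) (a b : nat -> R) k :
  p 0%N = 1 -> jacobi_parameters p a b -> (forall n, (1 <= n)%N -> 0 < a n) ->
  (1 <= k)%N ->
  (forall n, (k <= n)%N -> [/\ a n <= a n.+1, a n <= 1 & b n + 2 * a n <= 2]) ->
  ~ subordinate a b 2 (fun n => ((p n.-1).[2])%:C%C) ->
  exists2 m, (k <= m)%N &
    (p m.-1).[2] ^+ 2 < (p m.-1).[2] * (p m).[2].
Proof.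
move=> p0 pj a0 k1 edge nsub; apply: contrapT => none; apply: nsub.
apply: (decaying_subordinate a b (fun n => (p n.-1).[2]) a0 _ _ k k1 edge).
- exact: jacobi_three_term.
- by rewrite /= p0 hornerC.
move=> n kn; rewrite leNgt; apply/negP => lt; apply: none.
by exists n.
Qed.

Section NearEdge.
Context {R : realType}.

Lemma near_left_of_near (P : R -> Prop) :
  (\forall x \near (2 : R), P x) -> \forall x \near (2 : R)^'-, P x.
Proof. by move=> h; exact: cvg_within h. Qed.

(** A strict inequality at [2] between continuous functions persists near [2]. *)
Lemma near_edge_window (p : nat -> {poly R}) m (c : R) : c < 2 ->
  let u := (p m.-1).[2] in let v := (p m).[2] in
  u ^+ 2 < u * v ->
  exists q Q B : R, 0 < q /\ \forall x \near (2 : R)^'-,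
    [/\ 1 <= x < 2, c <= x, q <= (p m.-1).[x] ^+ 2 <= Q &
    (p m.-1).[x] ^+ 2 <= (p m.-1).[x] * (p m).[x] <= B * (p m.-1).[x] ^+ 2].
Proof.
move=> c2 u v uv.
have u0 : 0 < u ^+ 2.
  by rewrite exprn_even_gt0//=; apply/eqP => h; move: uv; rewrite h mul0r expr0n ltxx.
have uv0 := lt_trans u0 uv.
exists (u ^+ 2 / 2), (2 * u ^+ 2), (2 * (u * v) / (u ^+ 2 / 2)); split; first exact: divr_gt0.
have cu : {for (2 : R), continuous (fun x : R => (p m.-1).[x] ^+ 2)}.
  by apply: (@cvgM _ _ _ _ (horner (p m.-1)) (horner (p m.-1))); exact: continuous_horner.
have cv : {for (2 : R), continuous (fun x : R => (p m.-1).[x] * (p m).[x])}.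
  by apply: cvgM; exact: continuous_horner.
have cd : {for (2 : R), continuous (fun x : R => (p m.-1).[x] * (p m).[x] - (p m.-1).[x] ^+ 2)}.
  exact: cvgB cv cu.
near=> x.
have x2 : x < 2 by near: x; exact: nbhs_left_lt.
have h1 : u ^+ 2 / 2 <= (p m.-1).[x] ^+ 2.
  by near: x; apply: near_left_of_near; apply: (cvgr_ge _ cu); rewrite -/u; lra.
have h2 : (p m.-1).[x] ^+ 2 <= 2 * u ^+ 2.
  by near: x; apply: near_left_of_near; apply: (cvgr_le _ cu); rewrite -/u; lra.
have h3 : 0 <= (p m.-1).[x] * (p m).[x] - (p m.-1).[x] ^+ 2.
  by near: x; apply: near_left_of_near; apply: (cvgr_ge _ cd); rewrite -/u -/v; lra.
have h4 : (p m.-1).[x] * (p m).[x] <= 2 * (u * v).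
  by near: x; apply: near_left_of_near; apply: (cvgr_le _ cv); rewrite -/u -/v; lra.
split.
- by rewrite x2 andbT; near: x; apply: nbhs_left_ge; lra.
- by near: x; exact: nbhs_left_ge.
- by rewrite h1.
rewrite -subr_ge0 h3/=; apply: le_trans h4 _.
by rewrite mulrAC ler_pdivlMr ?divr_gt0// ler_pM2l// mulr_gt0.
Unshelve. all: by end_near. Qed.

End NearEdge.

Theorem theorem2 (R : realType) (mu : probability (measurableTypeR R) R)
    (p : nat -> {poly R}) (a b : nat -> R) (N0 : nat) (f : R -> R)
    (mu_compact : compactly_supported mu)
    (mu_nontrivial : nontrivial mu)
    (p_orthonormal : orthonormal_polynomials mu p)
    (p_jacobi : jacobi_parameters p a b)
    (a_gt0 : forall n, (1 <= n)%N -> 0 < a n)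
    (N0_ge1 : (1 <= N0)%N)
    (b_mono : forall n, (N0 <= n)%N -> b n <= b n.+1)
    (a_mono : forall n, (N0 <= n)%N -> a n <= a n.+1)
    (b_lim : b n @[n --> \oo] --> (0 : R))
    (a_lim : a n @[n --> \oo] --> (1 : R))
    (ab_nonconst : ~ (eventually_constant a /\ eventually_constant b))
    (f_density : ac_density mu f)
    (f_cont : {within `](-2), 2[, continuous f})
    (f_gt0 : forall x, -2 < x < 2 -> 0 < f x)
    (p_not_subordinate :
       ~ subordinate a b 2 (fun n => ((p n.-1).[2])%:C%C)) :
  exists C : R, \forall x \near (2 : R)^'-,
    (`|ln (f x) + 2 * \sum_(N0 <= n < (turning_index a b x).+1) gamma a b n x|%:E
     <= 2%:E * hfun a b x + C%:E)%E.
Proof.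
have [M M2 mu_supp] := compact_support_itv R mu mu_compact.
have bb := nondecreasing_from_le_lim b N0 0 b_mono b_lim.
have aa := nondecreasing_from_le_lim a N0 1 a_mono a_lim.
have edge_lt n : (N0 <= n)%N -> b n + 2 * a n < 2.
  move=> Nn; have /andP[_ bn] := bb n n Nn (leqnn n).
  have /andP[_ an] := aa n n Nn (leqnn n).
  rewrite ltNge; apply/negP => ge; apply: ab_nonconst.
  split; [exists 1|exists 0]; near=> k.
    have nk : (n <= k)%N by near: k; exact: nbhs_infty_ge.
    by have /andP[? ?] := aa n k Nn nk; lra.
  have nk : (n <= k)%N by near: k; exact: nbhs_infty_ge.
  by have /andP[? ?] := bb n k Nn nk; lra.
have [K1 hK1] : exists K1, forall n, (K1 <= n)%N -> 2^-1 <= a n /\ - 2^-1 <= b n.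
  have : \forall n \near \oo, 2^-1 <= a n /\ - 2^-1 <= b n.
    near=> n; split; near: n.
      by apply: (cvgr_ge (1 : R)) => //; lra.
    by apply: (cvgr_ge (0 : R)) => //; lra.
  by move=> [K1 _ h]; exists K1 => n; exact: h.
pose m0 := maxn N0 K1.
have m0N : (N0 <= m0)%N by exact: leq_maxl.
have edge n : (m0 <= n)%N -> [/\ a n <= a n.+1, a n <= 1 & b n + 2 * a n <= 2].
  move=> mn; have Nn := leq_trans m0N mn; split; first exact: a_mono.
    by have /andP[] := aa n n Nn (leqnn n).
  exact/ltW/edge_lt.
have p0 : p 0%N = 1 by case: p_orthonormal.
have [m mm0 grow] := growing_index R p a b m0 p0 p_jacobi a_gt0
  (leq_trans N0_ge1 m0N) edge p_not_subordinate.
have N0m : (N0 <= m)%N by exact: leq_trans mm0.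
have m1 : (1 <= m)%N by exact: leq_trans N0m.
have bnd n : (m <= n)%N -> 2^-1 <= a n <= 1 /\ - 2^-1 <= b n <= 0.
  move=> mn; have Nn := leq_trans N0m mn.
  have [h1 h2] := hK1 n (leq_trans (leq_maxr N0 K1) (leq_trans mm0 mn)).
  have /andP[_ bn] := bb n n Nn (leqnn n); have /andP[_ an] := aa n n Nn (leqnn n).
  by rewrite h1 h2 an bn.
have mono n : (m <= n)%N -> a n <= a n.+1 /\ b n <= b n.+1.
  by move=> mn; have Nn := leq_trans N0m mn; split; [exact: a_mono|exact: b_mono].
have edge_mono n k : (N0 <= n)%N -> (n <= k)%N -> b n + 2 * a n <= b k + 2 * a k.
  by move=> Nn nk; have /andP[? _] := bb n k Nn nk; have /andP[? _] := aa n k Nn nk; lra.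
have [q [Q [B [q0 window]]]] :=
  near_edge_window p m (b m.+1 + 2 * a m.+1) (edge_lt m.+1 (leqW N0m)) grow.
pose C1 := \sum_(N0 <= j < m) gamma a b j 2.
pose K := (64 * 160 * 49) / q; pose K' := 256 * (120 * 120) * (Q * (1 + 2 * B) ^+ 2).
exists (`|ln K| + `|ln K'| + 2 * C1).
near=> x.
have [x12 xm qQ uB] : [/\ 1 <= x < 2, b m.+1 + 2 * a m.+1 <= x,
    q <= (p m.-1).[x] ^+ 2 <= Q &
    (p m.-1).[x] ^+ 2 <= (p m.-1).[x] * (p m).[x] <= B * (p m.-1).[x] ^+ 2].
  by near: x.
have [x1 x2] : 1 <= x /\ x < 2 by have /andP[] := x12.
have xI : -2 < x < 2 by apply/andP; split; lra.
have f0 := f_gt0 x xI.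
have cf : {for x, continuous f}.
  move: f_cont; rewrite continuous_open_subspace; last exact: interval_open.
  by apply; rewrite inE/= in_itv.
have past : exists K, forall n, (K <= n)%N -> x < b n + 2 * a n.
  have : b n + 2 * a n @[n --> \oo] --> (0 + 2 * 1 : R).
    by apply: cvgD => //; apply: cvgM => //; exact: cvg_cst.
  move=> /cvgr_gt/(_ x); rewrite add0r mulr1 => /(_ x2)[K0 _ h].
  by exists K0 => n; exact: h.
have below0 : b N0 + 2 * a N0 <= x.
  by apply: le_trans xm; apply: edge_mono => //; exact: leqW.
have [T1 Tx Tmax] := turning_index_spec a b x N0 N0_ge1 below0 past.
rewrite /hfun /increment; set T := turning_index a b x in T1 Tx Tmax *.
have mT : (m < T)%N by exact: Tmax.
have xT : x < b T.+1 + 2 * a T.+1.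
  rewrite ltNge; apply/negP => /(Tmax T.+1 isT); by rewrite ltnn.
set D := b T.+2 - b T.+1 + a T.+2 - a T.+1.
(* the increment may vanish, and then [h] is infinite *)
case: ifPn => [_|D_neq0].
  by rewrite gt0_muley ?lte_fin// addye// leey.
have D0 : 0 < D.
  have [h1 h2] := mono T.+1 (leqW (ltnW mT)).
  by rewrite lt_neqAle eq_sym D_neq0/= /D; lra.
have [E0 r1 r2] := edge_estimate mu M M2 mu_supp p p_orthonormal a b p_jacobi a_lim b_lim
  f f_density m m1 bnd mono x x12 T B q Q (ltnW mT) cf f0 q0 Tx xT qQ uB D0.
have K0 : 0 < K by rewrite divr_gt0// mulr_gt0// mulr_gt0.
have K'0 : 0 < K'.
  rewrite ltNge; apply/negP => K'le; have := le_trans r2 (_ : _ <= 0).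
  rewrite ler10 -mulrA mulr_le0_ge0//; first by move/(_ isT).
  by rewrite mulr_ge0 ?sqr_ge0// mulr_ge0 ?sqr_ge0// ltW.
rewrite -EFinM -EFinD lee_fin.
have := ln_estimate (f x) _ _ K K' f0 (expR_gt0 _) E0 K0 K'0 r1 r2.
rewrite expRK (@big_cat_nat _ _ _ m N0 T.+1)//=; last by rewrite ltnW// ltnW.
have S0 : 0 <= \sum_(N0 <= j < m) gamma a b j x <= C1.
  have below j : (N0 <= j < m)%N -> 0 < a j /\ b j + 2 * a j <= x.
    move=> /andP[Nj jm]; split; first by apply: a_gt0; exact: leq_trans Nj.
    by apply: le_trans xm; apply: edge_mono => //; rewrite leqW// ltnW.
  rewrite /C1 !big_nat; apply/andP; split.
    by apply: sumr_ge0 => j /below[aj bj]; exact: gamma_ge0.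
  by apply: ler_sum => j /below[aj bj]; apply: ler_gamma => //; exact: ltW.
move: S0 => /andP[S0 S1]; rewrite !ler_norml => /andP[h1 h2].
by apply/andP; split; lra.
Unshelve. all: by end_near. Qed.
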